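(* The following $\binom n4$ quadrics and $\binom n5+\binom n6$ cubics form a reduced lexicographic Gröbner basis of the Plücker ideal $I_{L_n}$ for the variable order $p_{12}>p_{13}>\cdots>p_{1n}>p_{23}>\cdots>p_{2n}>\cdots>p_{n-2,n}>p_{n-1,n}$: $$Q_{ijkl}:=\underline{p_{ij}p_{kl}}-p_{ik}p_{jl}+p_{il}p_{jk}\quad\text{for } i<j<k<l,$$ $$C^{(5)}_{ijklm}:=\underline{p_{ik}p_{jl}p_{km}}-p_{ik}p_{jm}p_{kl}-p_{il}p_{jk}p_{km}+p_{im}p_{jk}p_{kl}\quad\text{for } i<j<k<l<m,$$ $$C^{(6)}_{ijklms}:=\underline{p_{il}p_{jm}p_{ks}}-p_{il}p_{js}p_{km}-p_{im}p_{jk}p_{ls}+p_{is}p_{jk}p_{lm}\quad\text{for } i<j<k<l<m<s,$$ where all indices lie in $\{1,\dots,n\}$ and the underlined monomials are the leading terms.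
   Context: Let $\mathbb{K}$ be a field and $S=\mathbb{K}[p_{ij}:1\le i<j\le n]$ the polynomial ring in the $\binom n2$ Plücker variables. The Plücker ideal $I_{L_n}\subset S$ is the kernel of the $\mathbb{K}$-algebra map $S\to\mathbb{K}[x_1,\dots,x_n,y_1,\dots,y_n]$, $p_{ij}\mapsto x_iy_j-x_jy_i$, i.e. the defining ideal of the homogeneous coordinate ring of the Grassmannian of lines $\mathrm{Gr}(2,n)$.
   Formalization: ''Reduced'' fails for n≥6: tails of C^{(6)} are divisible by the leading terms p_{jk}p_{ls}, p_{jk}p_{lm} of quadrics. Proved: the listed family is a minimal Gröbner basis; with C^{(6)} replaced by C^{(6)}+p_{im}Q_{jkls}-p_{is}Q_{jklm} it is the reduced one. *)

(* Defs.v *)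
From mathcomp Require Import all_boot all_order all_algebra zify ring.
From mathcomp Require Export mpoly.

Set Implicit Arguments.
Unset Strict Implicit.
Unset Printing Implicit Defensive.

Import Order.TTheory GRing.Theory.
Local Open Scope ring_scope.

Section Groebner.
Variables (K : fieldType) (N : nat).
Implicit Types (f g h : {mpoly K[N]}) (m : 'X_{1..N}) (G : seq {mpoly K[N]}).

(* mlead and the order on 'X_{1..N} provided by mpoly compare total degrees
   first; here exponent vectors are compared purely lexicographically, with
   'X_0 > 'X_1 > ... *)
Definition lexle m1 m2 : bool :=
  (((m1 : seq nat) : seqlexi nat) <= (m2 : seq nat))%O.

Definition lexmax m1 m2 := if lexle m1 m2 then m2 else m1.

Definition lexlead f : 'X_{1..N} := \big[lexmax/0%MM]_(m <- msupp f) m.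

Definition lead_term f : {mpoly K[N]} := f@_(lexlead f) *: 'X_[lexlead f].

Definition ideal_gen (A : {mpoly K[N]} -> Prop) f : Prop :=
  exists2 s : seq ({mpoly K[N]} * {mpoly K[N]}),
    forall x, x \in s -> A x.2 & f = \sum_(x <- s) x.1 * x.2.

Definition initial_ideal (A : {pred {mpoly K[N]}}) : {mpoly K[N]} -> Prop :=
  ideal_gen (fun t => exists2 f, f \in A & t = lead_term f).

Definition groebner_basis (I : {pred {mpoly K[N]}}) G : Prop :=
  {subset G <= I} /\
  forall f, initial_ideal I f <-> initial_ideal (mem G) f.

Definition minimal_groebner_basis (I : {pred {mpoly K[N]}}) G : Prop :=
  [/\ groebner_basis I G,
      forall g, g \in G -> g@_(lexlead g) = 1
    & forall g h, g \in G -> h \in G -> h != g ->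
        ~~ (lexlead h <= lexlead g)%MM].

Definition reduced_groebner_basis (I : {pred {mpoly K[N]}}) G : Prop :=
  [/\ groebner_basis I G,
      forall g, g \in G -> g@_(lexlead g) = 1
    & forall g h, g \in G -> h \in G -> h != g ->
        forall m, m \in msupp g -> ~~ (lexlead h <= m)%MM].

End Groebner.

Section Pluecker.
Variables (K : fieldType) (n : nat).
Implicit Types (i j k l m s : 'I_n).

Definition pair_index := {ij : 'I_n * 'I_n | (ij.1 < ij.2)%N}.

(* The number of Pluecker variables, see card_pair_index. *)
Definition npairs := #|{: pair_index}|.

(* The variable p_ij for i < j (indices start from 0), and 0 otherwise. The
   variables are numbered in the order p_12, p_13, ..., p_1n, p_23, ..., see
   enum_rank_pair_index. *)
Definition pvar i j : {mpoly K[npairs]} :=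
  if insub (i, j) is Some ij then 'X_(enum_rank (ij : pair_index)) else 0.

Definition xvar i : {mpoly K[n + n]} := 'X_(lshift n i).
Definition yvar i : {mpoly K[n + n]} := 'X_(rshift n i).

Definition pluecker_map (f : {mpoly K[npairs]}) : {mpoly K[n + n]} :=
  f \mPo [tuple let ij := val (enum_val v) in
                xvar ij.1 * yvar ij.2 - xvar ij.2 * yvar ij.1 | v < npairs].

Definition pluecker_ideal : {pred {mpoly K[npairs]}} :=
  [pred f | pluecker_map f == 0].

Local Notation p := pvar.

Definition quadric i j k l := p i j * p k l - p i k * p j l + p i l * p j k.

Definition cubic5 i j k l m :=
  p i k * p j l * p k m - p i k * p j m * p k l
    - p i l * p j k * p k m + p i m * p j k * p k l.

Definition cubic6 i j k l m s :=
  p i l * p j m * p k s - p i l * p j s * p k m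
    - p i m * p j k * p l s + p i s * p j k * p l m.

(* For i < j < k < l < m < s the last two monomials of cubic6 are divisible by
   the leading terms p_jk p_ls and p_jk p_lm of quadrics; reducing them gives
   the determinant of the matrix with rows i, j, k and columns l, m, s. *)
Definition cubic6_tail_reduced i j k l m s :=
  cubic6 i j k l m s + p i m * quadric j k l s - p i s * quadric j k l m.

Definition increasing d : {set d.-tuple 'I_n} :=
  [set t : d.-tuple 'I_n | sorted ltn (map val t)].

Definition quadrics : seq {mpoly K[npairs]} :=
  [seq quadric (tnth t 0) (tnth t 1) (tnth t 2) (tnth t 3)
  | t : 4.-tuple 'I_n in increasing 4].

Definition cubics5 : seq {mpoly K[npairs]} :=
  [seq cubic5 (tnth t 0) (tnth t 1) (tnth t 2) (tnth t 3) (tnth t 4)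
  | t : 5.-tuple 'I_n in increasing 5].

Definition cubics6 : seq {mpoly K[npairs]} :=
  [seq cubic6 (tnth t 0) (tnth t 1) (tnth t 2) (tnth t 3) (tnth t 4) (tnth t 5)
  | t : 6.-tuple 'I_n in increasing 6].

Definition cubics6_tail_reduced : seq {mpoly K[npairs]} :=
  [seq cubic6_tail_reduced (tnth t 0) (tnth t 1) (tnth t 2)
                           (tnth t 3) (tnth t 4) (tnth t 5)
  | t : 6.-tuple 'I_n in increasing 6].

End Pluecker.

Arguments pluecker_ideal K n : clear implicits.

Lemma card_pair_index n : npairs n = 'C(n, 2).
Proof.
rewrite -card_ltn_sorted_tuples /npairs card_sig.
rewrite -(card_imset _ (f := fun ij : 'I_n * 'I_n => [tuple ij.1; ij.2])).
  apply: eq_card => t; rewrite inE; apply/imsetP/idP => [[[i j]]|].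
    by rewrite inE /= => ij ->; rewrite /= andbT.
  case/tupleP: t => i t; case/tupleP: t => j t; rewrite (tuple0 t) /= andbT.
  by move=> ij; exists (i, j) => //; apply: val_inj.
by move=> [i j] [k l] /= [-> ->].
Qed.

Lemma enum_rank_pair_index n (a b : pair_index n) :
  (enum_rank a < enum_rank b)%N =
    ((val a).1 < (val b).1)%N ||
    ((val a).1 == (val b).1) && ((val a).2 < (val b).2)%N.
Proof.
pose r (u v : 'I_n * 'I_n) :=
  (u.1 < v.1)%N || (u.1 == v.1) && (u.2 < v.2)%N.
have r_trans : transitive r.
  by move=> [i j] [k l] [x y]; rewrite /r /= -!val_eqE /=; lia.
have r_irr : irreflexive r by move=> u; rewrite /r !ltnn andbF.
have sr : sorted r (map val (enum {: pair_index n})).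
  have -> : map val (enum {: pair_index n}) =
            filter (fun ij : 'I_n * 'I_n => (ij.1 < ij.2)%N) (enum {: 'I_n * 'I_n}).
    rewrite [in LHS]enumT [in LHS]unlock /= pmap_filter; last exact: insubK.
    by rewrite -enumT; apply: eq_filter => ij; apply: isSome_insub.
  apply: sorted_filter => //; rewrite enumT unlock /= /prod_enum.
  rewrite sorted_pairwise //.
  have ltI : pairwise (fun i j : 'I_n => (i < j)%N) (enum 'I_n).
    rewrite -(pairwise_map val ltn) val_enum_ord.
    by rewrite -sorted_pairwise ?iota_ltn_sorted //; exact: ltn_trans.
  suff ltII e : pairwise (fun i j : 'I_n => (i < j)%N) e ->
      pairwise r [seq (i, j) | i <- e, j <- enum 'I_n] by exact: ltII.
  elim: e => //= i e IH /andP[/allP lt_ie /IH {}IH].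
  rewrite pairwise_cat {}IH andbT pairwise_map; apply/andP; split.
    apply/allrelP=> _ _ /mapP[j _ ->] /allpairsP[[k l] /= [/lt_ie ik _ ->]].
    by rewrite /r /= ik.
  by apply: sub_pairwise ltI => j k jk; rewrite /r /= eqxx jk orbT.
have mono (c d : pair_index n) :
    (enum_rank c < enum_rank d)%N -> r (val c) (val d).
  move=> cd; have nthE (e : pair_index n) :
      nth (val c) (map val (enum {: pair_index n})) (enum_rank e) = val e.
    by rewrite (nth_map c) ?nth_enum_rank // -cardE.
  rewrite -(nthE c) -(nthE d); apply: (sorted_ltn_nth r_trans _ sr) cd;
    by rewrite inE size_map -cardE.
rewrite -[RHS]/(r (val a) (val b)).
have [ab|ba|/val_inj/enum_rank_inj ->] := ltngtP (enum_rank a) (enum_rank b).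
- by rewrite mono.
- apply/esym/negP => /r_trans /(_ (mono _ _ ba)).
  by rewrite r_irr.
- by rewrite r_irr.
Qed.

Lemma cubic6_tail_reducedE (K : fieldType) n (i j k l m s : 'I_n) :
  cubic6_tail_reduced K i j k l m s =
    pvar K i l * (pvar K j m * pvar K k s - pvar K j s * pvar K k m)
  - pvar K i m * (pvar K j l * pvar K k s - pvar K j s * pvar K k l)
  + pvar K i s * (pvar K j l * pvar K k m - pvar K j m * pvar K k l).
Proof.
by rewrite /cubic6_tail_reduced /cubic6 /quadric; ring.
Qed.

(* Main.v *)
Require Import Defs.
From mathcomp Require Import all_boot all_order all_algebra zify ring.

Set Implicit Arguments.
Unset Strict Implicit.
Unset Printing Implicit Defensive.

Import Order.TTheory GRing.Theory.
Local Open Scope ring_scope.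

(** A variable p_ij with i < j is read as an arc from i to j, and a monomial as a
    multiset of arcs. Its image under the Pluecker map is the product of the
    minors x_i y_j - x_j y_i over its arcs. An arc (k, l) lies beyond (i, j) when
    i < k and j < l. A multiset of arcs is standard when an arc beyond (i, j)
    never starts after j, and there are no three arcs each beyond the previous
    one. A violation of the first condition is a leading monomial p_ij p_kl of a
    quadric; if the first condition holds, three arcs (i, l), (j, m), (k, s) with
    i < j < k and l < m < s satisfy k <= l, and they form the leading monomial of
    a five-index cubic if k = l and of a six-index one if k < l. So the standard
    monomials are those divisible by none of the leading monomials of the
    listed generators ([lead_dichotomy]).

    The generators are in the ideal and have the stated leading terms by direct
    computation. What remains is that no nonzero f in the ideal has a standard
    leading monomial. If it had one, rewriting the other monomials of f modulo
    the generators into smaller standard ones ([normal_form]) would yield a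
    nonzero combination of standard monomials with zero image. Hence everything
    rests on [arc_prod_indep]: the images of the standard monomials are linearly
    independent.

    This is shown by induction on the number of letters, for all standard
    families with arcs in the letters m, ..., l, where l is the last letter.
    Specialize x_m to 0, which turns the minor of the arc (m, k) into x_k y_m up
    to sign. Among the members with nonzero coefficient choose one whose row of
    arcs (m, k) has the smallest sum of endpoints, and let b1 be the first
    endpoint of that row, or l if the row is empty. Extract the coefficient of
    the corresponding monomial in the x_k and y_m, keeping no other x_k with k >
    b1: by minimality only the members with that same row contribute
    ([weight_min], [peel_row]). In what is left, all arcs start at b1 or before,
    and those that end after b1 form an antichain, because together with the arc
    (m, b1) anything else would violate standardness ([row_threshold]). With x_k
    = 0 for k > b1 (the vectors of these letters become collinear) the minor of
    such an arc (i, k) is just x_i y_k. If b1 = l, the letter l itself plays the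
    role of the letters after b1. The resulting monomial in the y_k fixes how
    many arcs end in each k > b1, and forgetting it amounts to letting all these
    arcs end in the single letter l ([peel_cols]). An antichain is determined by
    its row and column sums ([antichain_eq]), so nothing is lost, and the merged
    families are standard. Finally x_l = 0 is harmless for a family of fixed
    degree: up to a power of y_l it can be achieved by a change of coordinates of
    the plane, realized by substituting the minor of (i, l) for x_i
    ([subst_merge]). The induction hypothesis applies to the letters after m.

    Minimality and reducedness are statements about sets of arcs, as the leading
    monomials are squarefree: no set of leading arcs contains another one
    ([is_lead_sub]), and none is contained in the arcs of a further term of a
    quadric, a five-index cubic or a tail-reduced six-index cubic
    ([red_expansion]). *)

(** * Finite sums of natural numbers *)

Lemma eq_sum_ltn (I : finType) (f g : I -> nat) i :
  (\sum_j f j = \sum_j g j)%N -> (g i < f i)%N ->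
  exists j, (f j < g j)%N.
Proof.
move=> eq_fg lt_i; apply/existsP; apply: contra_eqT eq_fg.
rewrite negb_exists => /forallP ge; rewrite gtn_eqF //.
rewrite (bigD1 i) //= [X in (_ < X)%N](bigD1 i) //= -addSn leq_add //.
by apply: leq_sum => j _; rewrite leqNgt.
Qed.

(** If R1 i j were larger than R2 i j, equality of the row and column sums would
    give entries R2 i l and R2 k j larger than those of R1. Agreement above and to
    the right forces l < j and i < k, against the antichain condition. *)
Lemma antichain_eq_sub (n : nat) (R1 R2 : 'I_n -> 'I_n -> nat) :
  (forall i j k l : 'I_n, 0 < R2 i j -> 0 < R2 k l -> i < k -> ~~ (j < l))%N ->
  (forall i, \sum_j R1 i j = \sum_j R2 i j)%N ->
  (forall j, \sum_i R1 i j = \sum_i R2 i j)%N ->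
  forall i j : 'I_n,
    (forall k l : 'I_n, k < i -> R1 k l = R2 k l)%N ->
    (forall l : 'I_n, j < l -> R1 i l = R2 i l)%N ->
    (R1 i j <= R2 i j)%N.
Proof.
move=> anti rows cols i j above right; rewrite leqNgt; apply/negP => lt_ij.
have [l lt_il] := eq_sum_ltn (rows i) lt_ij.
have [k lt_kj] := eq_sum_ltn (cols j) lt_ij.
have lj : (l < j)%N.
  case: (ltngtP l j) => // [jl|/val_inj e].
    by move: lt_il; rewrite right // ltnn.
  by move: lt_il lt_ij; rewrite e; lia.
have ik : (i < k)%N.
  case: (ltngtP i k) => // [ki|/val_inj e].
    by move: lt_kj; rewrite above // ltnn.
  by move: lt_kj lt_ij; rewrite -e; lia.
have := anti i l k j; rewrite lj ik => /(_ _ _ isT)/negP; apply => //; lia.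
Qed.

(** The two matrices are compared row by row from the top, and inside each row
    from right to left. *)
Lemma antichain_eq (n : nat) (R1 R2 : 'I_n -> 'I_n -> nat) :
  (forall i j k l : 'I_n, 0 < R1 i j -> 0 < R1 k l -> i < k -> ~~ (j < l))%N ->
  (forall i j k l : 'I_n, 0 < R2 i j -> 0 < R2 k l -> i < k -> ~~ (j < l))%N ->
  (forall i, \sum_j R1 i j = \sum_j R2 i j)%N ->
  (forall j, \sum_i R1 i j = \sum_i R2 i j)%N ->
  R1 =2 R2.
Proof.
move=> anti1 anti2 rows cols i.
have [k] := ubnP (i : nat); elim: k i => // k IHk i /ltnSE ik j.
have [l] := ubnP (n - j); elim: l j => // l IHl j /ltnSE jl.
have above (k' l' : 'I_n) : (k' < i)%N -> R1 k' l' = R2 k' l'.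
  by move=> lt; apply: IHk; apply: leq_trans ik.
have right (l' : 'I_n) : (j < l')%N -> R1 i l' = R2 i l'.
  by move=> lt; apply: IHl; have := ltn_ord l'; lia.
apply/eqP; rewrite eqn_leq !antichain_eq_sub // => *; first by rewrite above.
by rewrite right.
Qed.

(** Every term (k - b) (u0 k - u k) is nonnegative: u0 vanishes below b and
    dominates u above b. As u and u0 have the same total, the sum of these terms
    is the difference of the weights of u0 and u, which is not positive. So each
    term is zero, and u = u0 away from b, hence also at b. *)
Lemma weight_min (n : nat) (b : 'I_n) (u u0 : 'I_n -> nat) :
  (\sum_k u k = \sum_k u0 k)%N ->
  (forall k : 'I_n, k < b -> u0 k = 0)%N ->
  (forall k : 'I_n, b < k -> u k <= u0 k)%N ->
  (\sum_(k < n) k * u0 k <= \sum_(k < n) k * u k)%N ->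
  u =1 u0.
Proof.
move=> deg low high wt.
pose f (k : 'I_n) := (k * u0 k + b * u k)%N.
pose g (k : 'I_n) := (k * u k + b * u0 k)%N.
have fg k : (g k <= f k)%N.
  rewrite /f /g; case: (ltngtP k b) => [kb|bk|->]; last by lia.
    by rewrite low //; nia.
  by have := high _ bk; nia.
have eq_gf : (\sum_k g k = \sum_k f k)%N.
  apply/eqP; rewrite eqn_leq leq_sum //=.
  rewrite /f /g !big_split /= -!big_distrr /= deg.
  by rewrite leq_add2r.
have {fg eq_gf} gf k : g k = f k.
  apply/eqP; rewrite eqn_leq fg leqNgt /=; apply/negP => lt.
  by have [j] := eq_sum_ltn (esym eq_gf) lt; rewrite ltnNge fg.
have off k : k != b -> u k = u0 k.
  rewrite -val_eqE /= => kb; have := gf k; rewrite /f /g.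
  case: (ltngtP k b) kb => // [kb|bk] _.
    by rewrite low //; nia.
  by have := high _ bk; nia.
move=> k; have [->|/off //] := eqVneq k b.
move: deg; rewrite (bigD1 b) //= [RHS](bigD1 b) //=.
by rewrite (eq_bigr _ off) => /addIn.
Qed.

(** * Polynomials in which a variable does not occur *)

Section Avoid.
Variables (K : fieldType) (N : nat).
Implicit Types (p q : {mpoly K[N]}) (v : 'I_N).

Definition avoids v p := all (fun m : 'X_{1..N} => m v == 0%N) (msupp p).

Lemma avoids1 v : avoids v 1.
Proof. by rewrite /avoids msupp1 /= mnm0E eqxx. Qed.

Lemma avoidsX v w : w != v -> avoids v 'X_w.
Proof. by move=> wv; rewrite /avoids msuppX /= mnm1E (negbTE wv) eqxx. Qed.

Lemma avoidsM v p q : avoids v p -> avoids v q -> avoids v (p * q).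
Proof.
move=> /allP vp /allP vq; apply/allP => m /msuppM_le /allpairsP[[m1 m2]] /=.
by move=> [/vp/eqP m1v /vq/eqP m2v ->]; rewrite mnmDE m1v m2v.
Qed.

Lemma avoidsB v p q : avoids v p -> avoids v q -> avoids v (p - q).
Proof.
move=> /allP vp /allP vq; apply/allP => m /msuppB_le.
by rewrite mem_cat => /orP[/vp|/vq].
Qed.

Lemma avoids_exp v p k : (0 < k -> avoids v p)%N -> avoids v (p ^+ k).
Proof.
case: k => [|k] vp; first by rewrite expr0 avoids1.
by elim: k.+1 => [|d IHd]; rewrite ?expr0 ?avoids1 // exprS avoidsM ?vp.
Qed.

Lemma avoids_prod v (I : Type) (r : seq I) (P : pred I) F :
  (forall i, P i -> avoids v (F i)) -> avoids v (\prod_(i <- r | P i) F i).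
Proof. by move=> vF; elim/big_ind: _ => [|p q|//]; [apply: avoids1|apply: avoidsM]. Qed.

(** The coefficient of m + M t0 in the sum comes from the members with monomial
    M t0 alone, as soon as the terms of the other members cannot reach it. *)
Lemma monomial_part_eq0 (T : eqType) (s : seq T) (c : T -> K)
    (M : T -> 'X_{1..N}) (G : T -> {mpoly K[N]}) (t0 : T)
    (good : pred 'X_{1..N}) :
  \sum_(t <- s) c t *: (G t * 'X_[M t]) = 0 ->
  (forall t k m, t \in s -> c t != 0 -> k \in msupp (G t) -> good m ->
     (k + M t)%MM = (m + M t0)%MM -> M t = M t0) ->
  forall m, good m ->
    (\sum_(t <- s | (c t != 0) && (M t == M t0)) c t *: G t)@_m = 0.
Proof.
move=> sum0 onlyM m gm.
transitivity ((\sum_(t <- s) c t *: (G t * 'X_[M t]))@_(M t0 + m)); last first.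
  by rewrite sum0 mcoeff0.
rewrite !raddf_sum /= [LHS]big_mkcond /= big_seq [RHS]big_seq.
apply: eq_bigr => t ts; rewrite !mcoeffZ.
have [->|ct] := eqVneq (c t) 0; first by rewrite /= !mul0r.
have [->|Mt] /= := eqVneq (M t) (M t0); first by rewrite mcoeffMX.
rewrite [X in _ * X]memN_msupp_eq0 ?mulr0 //; apply: contraNN Mt.
move=> /msuppM_le /allpairsP[[k m']] /= [ks].
by rewrite msuppX mem_seq1 => /eqP -> /esym e; rewrite (onlyM t k m) // e addmC.
Qed.
End Avoid.

(** * Products of minors and their specializations *)

Section Minors.
Variables (K : fieldType) (n : nat).
Implicit Types (i j k l m : 'I_n) (e : 'I_n -> 'I_n -> nat).

Local Notation A := {mpoly K[n + n]}.
Local Notation x := (xvar K (n := n)).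
Local Notation y := (yvar K (n := n)).

Definition minor i j : A := x i * y j - x j * y i.

(** The image of the monomial with arc multiplicities e under the Pluecker map,
    see [pluecker_map_mon]. The multiplicities at pairs with j <= i are zero in all
    uses. *)
Definition arc_prod e : A := \prod_i \prod_j minor i j ^+ e i j.

(** Composition with [xypoint X Y] substitutes X i for x_i and Y i for y_i. *)
Definition xypoint (X Y : 'I_n -> A) : (n + n).-tuple A :=
  [tuple match split v with inl i => X i | inr j => Y j end | v < n + n].

Local Notation subst X Y := (comp_mpoly (xypoint X Y)).

Lemma subst_x X Y i : subst X Y (x i) = X i.
Proof.
by rewrite comp_mpolyXU -tnth_nth tnth_mktuple (unsplitK (inl i)).
Qed.

Lemma subst_y X Y i : subst X Y (y i) = Y i.
Proof.
by rewrite comp_mpolyXU -tnth_nth tnth_mktuple (unsplitK (inr i)).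
Qed.

Lemma subst_arc_prod X Y e :
  subst X Y (arc_prod e) =
    \prod_i \prod_j (X i * Y j - X j * Y i) ^+ e i j.
Proof.
rewrite rmorph_prod; apply: eq_bigr => i _; rewrite rmorph_prod.
by apply: eq_bigr => j _; rewrite rmorphXn /= rmorphB !rmorphM /= !subst_x !subst_y.
Qed.

Lemma eq_arc_prod e1 e2 : e1 =2 e2 -> arc_prod e1 = arc_prod e2.
Proof. by move=> e12; do 2!apply: eq_bigr => ? _; rewrite e12. Qed.

Definition xymon (a b : 'I_n -> nat) : 'X_{1..n + n} :=
  [multinom match split v with inl i => a i | inr j => b j end | v < n + n].

Lemma xymon_x a b i : xymon a b (lshift n i) = a i.
Proof. by rewrite mnmE (unsplitK (inl i)). Qed.

Lemma xymon_y a b i : xymon a b (rshift n i) = b i.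
Proof. by rewrite mnmE (unsplitK (inr i)). Qed.

Lemma mpolyX_xymon a b :
  'X_[xymon a b] = (\prod_i x i ^+ a i) * (\prod_i y i ^+ b i) :> A.
Proof.
rewrite mpolyXE_id big_split_ord /=.
by congr (_ * _); apply: eq_bigr => i _; rewrite ?xymon_x ?xymon_y.
Qed.

Lemma arc_prod_homog d e :
  (\sum_i \sum_j e i j = d)%N -> arc_prod e \is (2 * d)%N.-homog.
Proof.
have homM (I : finType) (F : I -> A) (D : I -> nat) :
    (forall a, F a \is (D a).-homog) -> \prod_a F a \is (\sum_a D a)%N.-homog.
  move=> hF; elim/big_ind2: _ => [|p1 d1 p2 d2 h1 h2|i _]; last exact: hF.
    exact: dhomog1.
  exact: dhomogM.
move=> <-; rewrite big_distrr /=; apply: (homM _ _) => i.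
rewrite big_distrr /=; apply: homM => j; apply: dhomogMn.
have var_homog v : ('X_v : A) \is 1.-homog by rewrite dhomogX /= mdeg1.
by apply: rpredB; apply: (dhomogM (d := 1) (e := 1)); apply: var_homog.
Qed.

Lemma avoids_y i k : i != k -> avoids (rshift n k) (y i).
Proof. by move=> ik; rewrite avoidsX // (inj_eq (@rshift_inj _ _)). Qed.
Lemma avoids_xy i k : avoids (rshift n k) (x i).
Proof. by rewrite avoidsX // eq_lrshift. Qed.

Lemma avoids_minor i j k :
  i != k -> j != k -> avoids (rshift n k) (minor i j).
Proof.
by move=> ik jk; rewrite avoidsB ?avoidsM ?avoids_y ?avoids_xy.
Qed.

Definition drop_row m e i j : nat := if i == m then 0%N else e i j.

Definition row_mon m e : 'X_{1..n + n} :=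
  xymon (e m) (fun j => if j == m then \sum_k e m k else 0)%N.

(** At x_m = 0 the minor of (m, k) is - x_k y_m; the sign is absorbed by
    substituting - y_m for y_m. *)
Lemma subst_first m e :
  (forall i j, 0 < e i j -> m <= i < j)%N ->
  subst (fun k => if k == m then 0 else x k)
        (fun k => if k == m then - y k else y k) (arc_prod e) =
    arc_prod (drop_row m e) * 'X_[row_mon m e].
Proof.
move=> e_supp; rewrite subst_arc_prod mpolyX_xymon.
rewrite (bigD1 m) //= [arc_prod _](bigD1 m) //= [in RHS]mulrC.
rewrite [X in _ = _ * (X * _)]big1 ?mul1r; last first.
  by move=> j _; rewrite /drop_row eqxx expr0.
congr (_ * _); last first.
  apply: eq_bigr => i im; apply: eq_bigr => j _; rewrite /drop_row (negbTE im).
  have [->|] := posnP (e i j); first by rewrite !expr0.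
  by move=> /e_supp/andP[mi ij]; rewrite -val_eqE gtn_eqF // (leq_ltn_trans mi).
rewrite [X in _ = _ * X](bigD1 m) //= eqxx [X in _ = _ * (_ * X)]big1 ?mulr1.
  rewrite -prodrXr -big_split /=; apply: eq_bigr => j _.
  have [->|] := posnP (e m j); first by rewrite !expr0 mulr1.
  move=> /e_supp/andP[_ mj].
  by rewrite -exprMn -val_eqE gtn_eqF // mul0r mulrN sub0r opprK.
by move=> j /negbTE->; rewrite expr0.
Qed.

Definition cols_mon (b : nat) e : 'X_{1..n + n} :=
  xymon (fun=> 0%N) (fun j => if (j < b)%N then 0 else \sum_i e i j)%N.

Definition half_prod (b : nat) e : A :=
  \prod_(i < n) \prod_(j < n) (if (j < b)%N then minor i j else x i) ^+ e i j.

(** For i < b <= j the minor of (i, j) becomes x_i y_j when the coordinates x_k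
    with b <= k vanish. The factors y_j are collected in [cols_mon], the others in
    [half_prod]. *)
Lemma subst_collinear (b : nat) e :
  (forall i j, 0 < e i j -> (i < j)%N && (i < b)%N)%N ->
  subst (fun k => if (k < b)%N then x k else 0) y (arc_prod e) =
    half_prod b e * 'X_[cols_mon b e].
Proof.
move=> e_supp; rewrite subst_arc_prod mpolyX_xymon.
rewrite [X in _ * (X * _)]big1 ?mul1r; last by move=> i _; rewrite expr0.
transitivity (half_prod b e *
    \prod_(i < n) \prod_(j < n) (if (j < b)%N then 1 else y j) ^+ e i j).
  rewrite -big_split; apply: eq_bigr => i _; rewrite -big_split.
  apply: eq_bigr => j _ /=; rewrite -exprMn.
  have [->|/e_supp/andP[ij ib]] := posnP (e i j); first by rewrite !expr0.
  by rewrite ib; case: ifP; rewrite ?mulr1 // mul0r subr0.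
congr (_ * _); rewrite exchange_big; apply: eq_bigr => j _ /=.
by case: ifP => _; rewrite prodrXr // expr1n expr0.
Qed.

Lemma avoids_half_prod (b : nat) e k :
  (forall i j, 0 < e i j -> (i < j)%N && (i < b)%N)%N -> (b <= k)%N ->
  avoids (rshift n k) (half_prod b e).
Proof.
move=> e_supp bk; do 2![apply: avoids_prod => ? _]; apply: avoids_exp.
move=> /e_supp/andP[_ ib]; case: ifP => jb; rewrite ?avoids_xy //.
by rewrite avoids_minor // -val_eqE ltn_eqF // (leq_trans _ bk).
Qed.

(** All arcs ending at b or later are made to end at l. *)
Definition merge_cols (b : nat) l e i j : nat :=
  if (j < b)%N then e i j else
  if j == l then (\sum_(k < n | ~~ (k < b)) e i k)%N else 0%N.

(** The substitution of the minors (k, l) for the x_k is, up to the factor y_l, a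
    change of coordinates that moves the vector of l to a coordinate axis: it
    multiplies each minor (i, j) by y_l and sends x_i to the minor of (i, l). *)
Lemma subst_merge (b : nat) l e :
  (b <= l)%N ->
  subst (fun k => minor k l) y (half_prod b e) =
    y l ^+ (\sum_i \sum_(j < n | j < b) e i j) * arc_prod (merge_cols b l e).
Proof.
move=> bl; rewrite rmorph_prod -prodrXr -big_split; apply: eq_bigr => i _ /=.
rewrite rmorph_prod /= (bigID (fun j : 'I_n => (j < b)%N)) /=.
rewrite [X in _ = _ * X](bigID (fun j : 'I_n => (j < b)%N)) /= mulrA.
congr (_ * _).
  rewrite -prodrXr -big_split; apply: eq_bigr => j jb /=.
  rewrite /merge_cols jb rmorphXn /= -exprMn rmorphB !rmorphM /= !subst_x !subst_y.
  by congr (_ ^+ _); rewrite /minor; ring.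
rewrite [RHS](bigD1 l) /= -?leqNgt // [X in _ = _ * X]big1 ?mulr1; last first.
  by move=> j /andP[/negbTE jb /negbTE jl]; rewrite /merge_cols jb jl.
rewrite /merge_cols ltnNge bl /= eqxx -prodrXr; apply: eq_bigr => j /negbTE jb.
by rewrite jb rmorphXn /= subst_x.
Qed.

End Minors.

(** * Standard families of arcs *)

Section StandardArcs.
Variables (n : nat).
Implicit Types (i j k l m : 'I_n) (e : 'I_n -> 'I_n -> nat).

(** No two arcs of the shape of a leading quadric term, and no three successive
    arcs in the product order. *)
Definition standard e : Prop :=
  (forall i j k l, 0 < e i j -> 0 < e k l -> i < k -> j < l -> k <= j)%N /\
  (forall i1 j1 i2 j2 i3 j3,
     0 < e i1 j1 -> 0 < e i2 j2 -> 0 < e i3 j3 ->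
     i1 < i2 < i3 -> ~~ (j1 < j2 < j3))%N.

Definition arcs_from (m : nat) e := (forall i j, 0 < e i j -> m <= i < j)%N.

Definition arc_count e := (\sum_i \sum_j e i j)%N.

(** Here b1 is the first endpoint of the row u, or l if there is none before l,
    and b is the smaller of b1 + 1 and l. If b1 < l, the arc (m, b1) is present:
    an arc of a later row starting after b1 would be disjoint from it, and two
    arcs ending after b1, one beyond the other, would form with it a chain of
    three. If b1 = l, only the arcs ending in l count as far, and both claims are
    obvious. *)
Lemma row_threshold m l (u : 'I_n -> nat) :
  (forall k, k <= l)%N ->
  exists (b1 : 'I_n) (b : nat),
  [/\ (b <= l)%N,
      forall k : 'I_n, (k < b1 -> u k = 0)%N,
      forall k : 'I_n, (b1 < k -> b <= k)%N
    & forall e, arcs_from m e -> standard e -> e m =1 u ->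
      (forall i j, 0 < drop_row m e i j -> i < b)%N /\
      (forall i j k l', 0 < drop_row m e i j -> 0 < drop_row m e k l' ->
         b <= j -> i < k -> ~~ (j < l'))%N].
Proof.
move=> lmax; pose P k := (k == l) || (0 < u k)%N.
have Pl : P l by rewrite /P eqxx.
have [b1 /orP Pb1 b1min] := @arg_minnP _ l P (@nat_of_ord n) Pl.
exists b1, (minn b1.+1 l).
split; first by rewrite geq_minr.
- move=> k; rewrite ltnNge; apply: contraNeq; rewrite -lt0n => uk.
  by apply: b1min; rewrite /P uk orbT.
- by move=> k bk; rewrite geq_min bk.
move=> e supp [disj chain] eu.
have restP i j : (0 < drop_row m e i j)%N -> (m < i < j)%N /\ (0 < e i j)%N.
  rewrite /drop_row -val_eqE; case: ifP => //= im eij; split=> //.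
  by have := supp _ _ eij; lia.
split=> [i j /restP[/andP[mi ij] eij]|].
  have jl := lmax j.
  case: Pb1 => [/eqP ->|]; first by rewrite leq_min; lia.
  rewrite -eu => emb.
  rewrite leq_min (leq_trans ij jl) andbT ltnS leqNgt; apply/negP => bi.
  by have := disj _ _ _ _ emb eij mi (ltn_trans bi ij); rewrite leqNgt bi.
move=> i j k l' /restP[/andP[mi ij] eij] /restP[/andP[mk kl] ekl].
move=> bj ik; apply/negP => jl'.
have l'l := lmax l'; move: bj; rewrite geq_min => /orP[bj|]; last by lia.
case: Pb1 => [/eqP e1|]; first by move: bj; rewrite e1; lia.
rewrite -eu => emb.
by have := chain _ _ _ _ _ _ emb eij ekl; rewrite mi ik jl' bj => /(_ isT).
Qed.

Lemma merge_pos (b : nat) l e i j :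
  (0 < merge_cols b l e i j)%N ->
  (j < b)%N /\ (0 < e i j)%N \/
  [/\ j = l, (b <= l)%N & exists k : 'I_n, (b <= k)%N /\ (0 < e i k)%N].
Proof.
rewrite /merge_cols; case: (ltnP j b) => [jb p|bj]; first by left.
case: eqP => // jl; rewrite lt0n sum_nat_eq0 negb_forall => /existsP[k].
rewrite negb_imply -leqNgt -lt0n => /andP[bk eik].
by right; split=> //; [rewrite -jl | exists k].
Qed.

Lemma standard_drop_row m e : standard e -> standard (drop_row m e).
Proof.
have restP i j : (0 < drop_row m e i j)%N -> (0 < e i j)%N.
  by rewrite /drop_row; case: ifP.
move=> [disj chain]; split=> [i j k l /restP p1 /restP p2|].
  exact: disj.
move=> i1 j1 i2 j2 i3 j3 /restP p1 /restP p2 /restP; exact: chain.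
Qed.

Lemma standard_merge (b : nat) l e :
  (forall k, k <= l)%N -> standard e -> standard (merge_cols b l e).
Proof.
move=> lmax [disj chain].
have lift i j (j0 : 'I_n) : (j0 < b)%N -> (0 < merge_cols b l e i j)%N -> (j0 < j)%N ->
    exists2 j' : 'I_n, (j0 < j')%N & (0 < e i j')%N.
  move=> j0b /merge_pos[[jb p]|[-> bl [k [bk p]]]] jj; first by exists j.
  by exists k => //; apply: leq_trans bk.
have low i j (k : 'I_n) : (0 < merge_cols b l e i j)%N -> (j < k)%N ->
    (j < b)%N /\ (0 < e i j)%N.
  by move=> /merge_pos[//|[-> _ _]]; rewrite ltnNge lmax.
split=> [i j k l' p1 p2 ik jl'|i1 j1 i2 j2 i3 j3 p1 p2 p3 i123].
  have [jb {}p1] := low _ _ _ p1 jl'.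
  by have [l'' jl'' {}p2] := lift _ _ _ jb p2 jl'; apply: disj p1 p2 ik jl''.
apply/negP => /andP[j12 j23].
have [j1b {}p1] := low _ _ _ p1 j12; have [j2b {}p2] := low _ _ _ p2 j23.
have [j3' j23' {}p3] := lift _ _ _ j2b p3 j23.
by have := chain _ _ _ _ _ _ p1 p2 p3 i123; rewrite j12 j23'.
Qed.

Lemma arc_count_drop_row m e : (arc_count e = \sum_k e m k + arc_count (drop_row m e))%N.
Proof.
rewrite /arc_count (bigD1 m) //= [X in (_ = _ + X)%N](bigD1 m) //=.
rewrite [X in (_ = _ + (X + _))%N]big1 ?add0n; last by move=> k _; rewrite /drop_row eqxx.
by congr (_ + _)%N; apply: eq_bigr => i /negbTE im; rewrite /drop_row im.
Qed.

Lemma merge_row (b : nat) l e i :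
  (b <= l)%N -> (\sum_j merge_cols b l e i j = \sum_j e i j)%N.
Proof.
move=> bl; rewrite (bigID (fun j : 'I_n => (j < b)%N)) /=.
rewrite [RHS](bigID (fun j : 'I_n => (j < b)%N)) /=; congr (_ + _)%N.
  by apply: eq_bigr => j jb; rewrite /merge_cols jb.
rewrite (bigD1 l) /= -?leqNgt // big1 ?addn0.
  by rewrite /merge_cols ltnNge bl eqxx.
by move=> j /andP[/negbTE jb /negbTE jl]; rewrite /merge_cols jb jl.
Qed.

(** The arcs ending before b are untouched. The far arcs form an antichain whose
    row sums are kept by the merging and whose column sums agree by hypothesis. *)
Lemma merge_inj (b : nat) l e1 e2 :
  (b <= l)%N ->
  (forall i j k l', (0 < e1 i j -> 0 < e1 k l' -> b <= j -> i < k -> ~~ (j < l'))%N) ->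
  (forall i j k l', (0 < e2 i j -> 0 < e2 k l' -> b <= j -> i < k -> ~~ (j < l'))%N) ->
  (forall j : 'I_n, b <= j -> \sum_i e1 i j = \sum_i e2 i j)%N ->
  merge_cols b l e1 =2 merge_cols b l e2 -> e1 =2 e2.
Proof.
move=> bl anti1 anti2 cols eq_merge.
have low i j : (j < b)%N -> e1 i j = e2 i j.
  by move=> jb; have := eq_merge i j; rewrite /merge_cols jb.
pose R e i j := if (b <= j)%N then e i j else 0%N.
have R_anti e :
    (forall i j k l', (0 < e i j -> 0 < e k l' -> b <= j -> i < k -> ~~ (j < l'))%N) ->
   forall i j k l' : 'I_n, (0 < R e i j -> 0 < R e k l' -> i < k -> ~~ (j < l'))%N.
  move=> anti i j k l'; rewrite /R; do 2![case: ifP => //] => _ bj p1 p2 ik.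
  exact: anti p1 p2 bj ik.
have R12 : R e1 =2 R e2.
  apply: antichain_eq; [exact: R_anti | exact: R_anti | move=> i | move=> j].
    have sumR e : (\sum_j R e i j = merge_cols b l e i l)%N.
      rewrite /merge_cols ltnNge bl /= eqxx [RHS]big_mkcond.
      by apply: eq_bigr => j _; rewrite /R -leqNgt.
    by rewrite !sumR eq_merge.
  by rewrite /R; case: (leqP b j) => [bj|_]; [exact: cols|].
move=> i j; case: (ltnP j b) => [|bj]; first exact: low.
by have := R12 i j; rewrite /R bj.
Qed.
End StandardArcs.

(** * Linear independence of the products over standard families *)

Lemma seq_argmin (T : eqType) (s : seq T) (P : pred T) (w : T -> nat) t :
  t \in s -> P t ->
  exists t0, [/\ t0 \in s, P t0 & forall t, t \in s -> P t -> (w t0 <= w t)%N].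
Proof.
move=> ts Pt; pose Q k := has (fun t => P t && (w t == k)) s.
have exQ : exists k, Q k by exists (w t); apply/hasP; exists t; rewrite ?Pt /=.
case: (ex_minnP exQ) => k /hasP[t0 t0s /andP[Pt0 /eqP <-]] min.
exists t0; split=> // t' t's Pt'.
by apply: min; apply/hasP; exists t'; rewrite ?Pt' /=.
Qed.

Section IndepTools.
Variables (K : fieldType) (n : nat).
Implicit Types (i j k l m : 'I_n) (e : 'I_n -> 'I_n -> nat).
Local Notation A := {mpoly K[n + n]}.
Local Notation x := (xvar K (n := n)).
Local Notation y := (yvar K (n := n)).
Local Notation subst X Y := (comp_mpoly (xypoint X Y)).

Lemma avoids_sum (N : nat) (T : Type) (s : seq T) (P : pred T) (c : T -> K) F (v : 'I_N) :
  (forall t, P t -> avoids v (F t)) ->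
  avoids v (\sum_(t <- s | P t) c t *: F t).
Proof.
move=> vF; elim/big_ind: _ => [|p q /allP vp /allP vq|t Pt].
- by rewrite /avoids msupp0.
- by apply/allP => m /msuppD_le; rewrite mem_cat => /orP[/vp|/vq].
- by apply/allP => m /msuppZ_le /(allP (vF t Pt)).
Qed.

Lemma avoids_coef (N : nat) (p : {mpoly K[N]}) v (m : 'X_{1..N}) :
  avoids v p -> (m v != 0)%N -> p@_m = 0.
Proof.
move=> /allP vp mv; apply/eqP; rewrite mcoeff_eq0; apply: contra mv; exact: vp.
Qed.

Lemma subst_low_eq0 (b : nat) (f : A) :
  (forall m : 'X_{1..n + n}, (forall i, b <= i -> m (lshift n i) = 0)%N -> f@_m = 0) ->
  subst (fun k => if (k < b)%N then x k else 0) y f = 0.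
Proof.
move=> low; rewrite [f]mpolyE raddf_sum /= big_seq big1 // => m.
rewrite mcoeff_msupp => fm; rewrite linearZ /= comp_mpolyX.
have [i bi mi] : exists2 i : 'I_n, (b <= i)%N & m (lshift n i) != 0%N.
  apply/exists_inP; apply: contraNT fm; rewrite negb_exists_in => /forall_inP fm.
  by apply/eqP/low => i bi; apply/eqP; have := fm i bi; rewrite negbK.
rewrite (bigD1 (lshift n i)) //= tnth_mktuple (unsplitK (inl i)) /= ltnNge bi /=.
by rewrite expr0n (negbTE mi) mul0r scaler0.
Qed.

Lemma eq_row_mon m e1 e2 : e1 m =1 e2 m -> row_mon m e1 = row_mon m e2.
Proof.
move=> e12; apply/mnmP => v; rewrite !mnmE; case: split => i //.
by case: eqP => // _; apply: eq_bigr.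
Qed.

Lemma row_mon_eq m e1 e2 : row_mon m e1 = row_mon m e2 -> e1 m =1 e2 m.
Proof.
move=> e12 i; have := congr1 (fun M : 'X_{1.._} => M (lshift n i)) e12.
by rewrite !xymon_x.
Qed.

Lemma cols_mon_eq (b : nat) e1 e2 : cols_mon b e1 = cols_mon b e2 ->
  forall j : 'I_n, (b <= j -> \sum_i e1 i j = \sum_i e2 i j)%N.
Proof.
move=> e12 j bj; have := congr1 (fun M : 'X_{1.._} => M (rshift n j)) e12.
by rewrite !xymon_y ltnNge bj.
Qed.

Lemma arc_count_low (b : nat) e1 e2 :
  arc_count e1 = arc_count e2 -> cols_mon b e1 = cols_mon b e2 ->
  (\sum_i \sum_(j < n | j < b) e1 i j = \sum_i \sum_(j < n | j < b) e2 i j)%N.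
Proof.
move=> cnt /cols_mon_eq cols; move: cnt; rewrite /arc_count.
have splitE e : (\sum_i \sum_j e i j = \sum_i \sum_(j < n | j < b) e i j +
     \sum_(j < n | ~~ (j < b)) \sum_i e i j)%N.
  rewrite [X in (_ = _ + X)%N]exchange_big -big_split.
  by apply: eq_bigr => i _; rewrite (bigID (fun j : 'I_n => (j < b)%N)).
rewrite !splitE [X in (_ = _ + X)%N](eq_bigr (fun j => \sum_i e1 i j)%N).
  by move/addIn.
by move=> j; rewrite -leqNgt => bj; rewrite cols.
Qed.
End IndepTools.

Section Indep.
Variables (K : fieldType) (n : nat) (T : eqType).
Implicit Types (i j k l m : 'I_n) (e : 'I_n -> 'I_n -> nat).
Implicit Types (s : seq T) (E : T -> 'I_n -> 'I_n -> nat) (c : T -> K).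
Local Notation A := {mpoly K[n + n]}.
Local Notation x := (xvar K (n := n)).
Local Notation y := (yvar K (n := n)).
Local Notation subst X Y := (comp_mpoly (xypoint X Y)).

(** The specialization x_m = 0, followed by the extraction of the monomial of the
    row of t0. The monomials allowed besides it contain neither y_m, which makes
    the rows compared have the same size, nor any x_k with b <= k, which makes the
    row of t0 dominate the other one after b1. *)
Lemma peel_row m (b1 : 'I_n) (b : nat) s E c t0 :
  (forall t, t \in s -> arcs_from m (E t)) ->
  (forall k : 'I_n, (k < b1 -> E t0 m k = 0)%N) ->
  (forall k : 'I_n, (b1 < k -> b <= k)%N) ->
  (forall t, t \in s -> c t != 0%R ->
     \sum_(k < n) k * E t0 m k <= \sum_(k < n) k * E t m k)%N ->
  \sum_(t <- s) c t *: arc_prod K (E t) = 0 ->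
  subst (fun k => if (k < b)%N then x k else 0) y
    (\sum_(t <- s | (c t != 0) && (row_mon m (E t) == row_mon m (E t0)))
        c t *: arc_prod K (drop_row m (E t))) = 0.
Proof.
move=> supp low high wmin.
move/(congr1 (subst (fun k => if k == m then 0 else x k)
                    (fun k => if k == m then - y k else y k))).
rewrite raddf0 raddf_sum /= => sum0.
(* The remaining arcs start after m. *)
have avoid_m t : t \in s -> avoids (rshift n m) (arc_prod K (drop_row m (E t))).
  move=> ts; do 2![apply: avoids_prod => ? _]; apply: avoids_exp.
  rewrite /drop_row; case: ifP => // /negbT im /(supp _ ts)/andP[mi ij].
  by rewrite avoids_minor // -val_eqE gtn_eqF // (leq_ltn_trans mi).
have {}sum0 : \sum_(t <- s) c t *:
    (arc_prod K (drop_row m (E t)) * 'X_[row_mon m (E t)]) = 0.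
  rewrite -[RHS]sum0 [LHS]big_seq [RHS]big_seq; apply: eq_bigr => t ts.
  by rewrite linearZ /= subst_first //; apply: supp.
pose good (q : 'X_{1..n + n}) :=
  [forall i : 'I_n, (b <= i)%N ==> (q (lshift n i) == 0%N)] && (q (rshift n m) == 0%N).
have only t r q : t \in s -> c t != 0 -> r \in msupp (arc_prod K (drop_row m (E t))) ->
    good q -> (r + row_mon m (E t))%MM = (q + row_mon m (E t0))%MM ->
    row_mon m (E t) = row_mon m (E t0).
  move=> ts ct kt /andP[/forallP qx /eqP qy] kq; apply: eq_row_mon.
  have at_ v := congr1 (fun M : 'X_{1..n + n} => M v) kq.
  apply: (@weight_min n b1) => //; last exact: wmin.
    have := at_ (rshift n m); rewrite !mnmDE !xymon_y eqxx qy.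
    by have /allP/(_ r kt)/eqP -> := avoid_m t ts.
  move=> i /high bi; have := at_ (lshift n i); rewrite !mnmDE !xymon_x.
  by have := qx i; rewrite bi => /eqP ->; rewrite add0n => <-; apply: leq_addl.
have coef0 := monomial_part_eq0 sum0 only.
apply: subst_low_eq0 => q qx.
have [qy|qy] := eqVneq (q (rshift n m)) 0%N.
  apply: coef0; rewrite /good qy eqxx andbT; apply/forallP => i.
  by apply/implyP => bi; rewrite qx.
apply: avoids_coef qy; rewrite big_seq_cond.
by apply: avoids_sum => t /andP[ts _]; apply: avoid_m.
Qed.

(** The number of arcs ending before b is the same for all the members that are
    kept, so that [subst_merge] produces the same power of y_l for each. *)
Lemma peel_cols (b : nat) (l : 'I_n) s E c t0 :
  (b <= l)%N -> t0 \in s ->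
  (forall t, t \in s ->
     forall i j, (0 < E t i j -> (i < j) && (i < b))%N) ->
  (forall t, t \in s -> arc_count (E t) = arc_count (E t0)) ->
  subst (fun k => if (k < b)%N then x k else 0) y
    (\sum_(t <- s) c t *: arc_prod K (E t)) = 0 ->
  \sum_(t <- s | (c t != 0) && (cols_mon b (E t) == cols_mon b (E t0)))
     c t *: arc_prod K (merge_cols b l (E t)) = 0.
Proof.
move=> bl t0s supp cnt; rewrite raddf_sum /= => sum0.
have {}sum0 : \sum_(t <- s) c t *:
    (half_prod K b (E t) * 'X_[cols_mon b (E t)]) = 0.
  rewrite -[RHS]sum0 [LHS]big_seq [RHS]big_seq; apply: eq_bigr => t ts.
  by rewrite linearZ /= subst_collinear //; apply: supp.
have avoid_b t j : t \in s -> (b <= j)%N -> avoids (rshift n j) (half_prod K b (E t)).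
  by move=> ts bj; apply: avoids_half_prod => //; apply: supp.
pose good (q : 'X_{1..n + n}) :=
  [forall j : 'I_n, (b <= j)%N ==> (q (rshift n j) == 0%N)].
have only t r q : t \in s -> c t != 0 -> r \in msupp (half_prod K b (E t)) ->
    good q -> (r + cols_mon b (E t))%MM = (q + cols_mon b (E t0))%MM ->
    cols_mon b (E t) = cols_mon b (E t0).
  move=> ts ct kt /forallP qy kq; apply/mnmP => v.
  rewrite -(splitK v); case: (split v) => j /=; first by rewrite !xymon_x.
  case: (ltnP j b) => bj; first by rewrite !xymon_y bj.
  have := congr1 (fun M : 'X_{1..n + n} => M (rshift n j)) kq.
  rewrite !mnmDE; have /allP/(_ r kt)/eqP -> := avoid_b t j ts bj.
  by have := qy j; rewrite bj => /eqP ->.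
have coef0 := monomial_part_eq0 sum0 only.
have {}sum0 : \sum_(t <- s | (c t != 0) && (cols_mon b (E t) == cols_mon b (E t0)))
     c t *: half_prod K b (E t) = 0.
  apply/mpolyP => q; rewrite mcoeff0; have [/coef0 //|] := boolP (good q).
  rewrite negb_forall => /existsP[j]; rewrite negb_imply => /andP[bj].
  apply: avoids_coef; rewrite big_seq_cond.
  by apply: avoids_sum => t /andP[ts _]; apply: avoid_b.
have := congr1 (subst (fun k => minor K k l) y) sum0.
rewrite raddf0 raddf_sum /=.
pose N0 := (\sum_i \sum_(j < n | j < b) E t0 i j)%N.
rewrite [X in X = 0 -> _](_ : _ = y l ^+ N0 *
  \sum_(t <- s | (c t != 0) && (cols_mon b (E t) == cols_mon b (E t0)))
     c t *: arc_prod K (merge_cols b l (E t))); last first.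
  rewrite big_distrr big_seq_cond [RHS]big_seq_cond; apply: eq_bigr => t.
  move=> /andP[ts /andP[_ /eqP ecols]].
  rewrite linearZ /= subst_merge // -scalerAr.
  by rewrite (arc_count_low (cnt t ts) ecols).
by move/eqP; rewrite mulf_eq0 expf_eq0 -msupp_eq0 msuppX andbF => /eqP.
Qed.

(** The families are indexed by an arbitrary type, so that the members of the
    original sum keep their names while their arcs are dropped and merged. The
    common degree d makes the power of y_l in [peel_cols] constant. *)
Lemma arc_prod_indep (d k m : nat) s E c :
  (m + k = n)%N -> uniq s ->
  (forall t, t \in s -> arcs_from m (E t)) ->
  (forall t, t \in s -> standard (E t)) ->
  (forall t, t \in s -> arc_count (E t) = d) ->
  (forall t1 t2, t1 \in s -> t2 \in s -> E t1 =2 E t2 -> t1 = t2) ->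
  \sum_(t <- s) c t *: arc_prod K (E t) = 0 ->
  forall t, t \in s -> c t = 0.
Proof.
elim: k m s E d => [|k IHk] m s E d mk us supp std cnt inj sum0 t ts.
  have E0 t' : t' \in s -> E t' =2 fun _ _ => 0%N.
    move=> /supp supp' i j; apply/eqP; rewrite -leqn0 leqNgt; apply/negP => /supp'.
    by move=> /andP[mi _]; have := ltn_ord i; lia.
  have s1 t' : t' \in s -> t' = t.
    by move=> t's; apply: inj => // i j; rewrite !E0.
  move: sum0; rewrite (bigD1_seq t) //= big_seq_cond big1 ?addr0.
    rewrite (eq_arc_prod _ (E0 t ts)) /arc_prod big1 => [|i _]; last first.
      by rewrite big1.
    by move/(congr1 (mcoeff 0)); rewrite mcoeffZ mcoeff1 eqxx mulr1 mcoeff0.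
  by move=> t' /andP[/s1 ->]; rewrite eqxx.
apply/eqP; apply: contraT => ct.
have mn : (m < n)%N by lia.
pose M : 'I_n := Ordinal mn.
have ln : (n.-1 < n)%N by lia.
pose l : 'I_n := Ordinal ln.
have lmax (j : 'I_n) : (j <= l)%N by have := ltn_ord j; rewrite /=; lia.
have [t0 [t0s ct0 wmin]] := @seq_argmin T s (fun t => c t != 0)
  (fun t => \sum_(k < n) k * E t M k)%N t ts ct.
have [b1 [b [bl low high]]] := row_threshold M (E t0 M) lmax.
move=> splitP.
have rowP t1 : t1 \in s -> row_mon M (E t1) = row_mon M (E t0) -> _ :=
  fun t1s row => splitP _ (supp t1 t1s) (std t1 t1s) (row_mon_eq row).
have restP t1 i j : t1 \in s -> (0 < drop_row M (E t1) i j -> m < i < j)%N.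
  move=> t1s; rewrite /drop_row -val_eqE; case: ifP => //= im /(supp _ t1s); lia.
have := @peel_row M b1 b s E c t0 supp low high wmin sum0.
rewrite -big_filter; set s2 := [seq t <- s | _] => sum2.
have s2P t1 : t1 \in s2 -> [/\ t1 \in s, c t1 != 0 & row_mon M (E t1) = row_mon M (E t0)].
  by rewrite mem_filter => /andP[/andP[ct1 /eqP row] t1s].
have t0s2 : t0 \in s2 by rewrite mem_filter ct0 eqxx.
pose d0 := (\sum_j E t0 M j)%N.
have cnt2 t1 : t1 \in s2 -> arc_count (drop_row M (E t1)) = (d - d0)%N.
  move=> /s2P[t1s _ /row_mon_eq row]; rewrite -(cnt t1 t1s) (arc_count_drop_row M (E t1)).
  by rewrite [X in (X + _)%N](eq_bigr (E t0 M)) ?addKn.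
have supp2 t1 : t1 \in s2 ->
    forall i j, (0 < drop_row M (E t1) i j -> (i < j) && (i < b))%N.
  move=> /s2P[t1s _ row] i j p; have /andP[_ ->] := restP t1 i j t1s p.
  by have [/(_ i j p)] := rowP t1 t1s row.
have eq_cnt2 t1 : t1 \in s2 ->
    arc_count (drop_row M (E t1)) = arc_count (drop_row M (E t0)).
  by move=> t1s; rewrite !cnt2.
have := peel_cols bl t0s2 supp2 eq_cnt2 sum2.
rewrite -big_filter; set s3 := [seq t <- s2 | _] => sum3.
have s3P t1 : t1 \in s3 -> t1 \in s2 /\
    cols_mon b (drop_row M (E t1)) = cols_mon b (drop_row M (E t0)).
  by rewrite mem_filter => /andP[/andP[_ /eqP cols] t1s].
have t0s3 : t0 \in s3 by rewrite mem_filter ct0 eqxx.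
(* The induction hypothesis, applied to the merged families of s3. *)
suff : c t0 = 0 by move/eqP; rewrite (negbTE ct0).
apply: (IHk m.+1 s3 (fun t => merge_cols b l (drop_row M (E t))) (d - d0)%N) => //.
- lia.
- by rewrite !filter_uniq.
- move=> t1 /s3P[/s2P[t1s _ row] _] i j /merge_pos[[_]|[-> _ [j' [_]]]] /=.
    exact: restP.
  move=> p; have /andP[-> _] := restP t1 i j' t1s p.
  by have [/(_ i j' p) ib _] := rowP t1 t1s row; apply: leq_trans bl.
- by move=> t1 /s3P[/s2P[t1s _ _] _]; apply/standard_merge/standard_drop_row/std.
- move=> t1 /s3P[t1s _]; rewrite -(cnt2 t1 t1s); apply: eq_bigr => i _.
  exact: merge_row.
- move=> t1 t2 /s3P[t1s2 cols1] /s3P[t2s2 cols2] eq12.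
  have [t1s _ row1] := s2P _ t1s2; have [t2s _ row2] := s2P _ t2s2.
  apply: inj => // i j.
  have [_ anti1] := rowP t1 t1s row1; have [_ anti2] := rowP t2 t2s row2.
  have eq_rest := merge_inj bl anti1 anti2
    (cols_mon_eq (etrans cols1 (esym cols2))) eq12.
  have [->|/negbTE iM] := eqVneq i M.
    by rewrite (row_mon_eq row1) (row_mon_eq row2).
  by have := eq_rest i j; rewrite /drop_row iM.
Qed.
End Indep.

(** * The lexicographic order and Groebner bases *)

Section Lex.
Variable (N : nat).
Implicit Types (m : 'X_{1..N}).

Definition lexlt m1 m2 : bool := (m1 != m2) && lexle m1 m2.

Lemma lexle_refl m : lexle m m. Proof. exact: lexx. Qed.

Lemma lexle_trans m2 m1 m3 : lexle m1 m2 -> lexle m2 m3 -> lexle m1 m3.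
Proof. exact: le_trans. Qed.

Lemma lexle_anti m1 m2 : lexle m1 m2 -> lexle m2 m1 -> m1 = m2.
Proof.
move=> m12 m21; do 2!apply: val_inj.
by apply: (@le_anti _ (seqlexi nat)); rewrite [X in X && _]m12.
Qed.

Lemma lexle_total m1 m2 : lexle m1 m2 || lexle m2 m1.
Proof. exact: le_total. Qed.

(** Two exponent vectors are compared at the first variable where they differ. *)
Lemma lexltP m1 m2 :
  reflect (exists2 k : 'I_N, forall i : 'I_N, (i < k)%N -> m1 i = m2 i & (m1 k < m2 k)%N)
          (lexlt m1 m2).
Proof.
have -> : lexlt m1 m2 = ((m1 : N.-tuplelexi nat) < (m2 : N.-tuplelexi nat))%O.
  by rewrite lt_neqAle.
exact: ltxi_tuplePlt.
Qed.

Lemma lexlt_add m m1 m2 : lexlt m1 m2 -> lexlt (m + m1)%MM (m + m2)%MM.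
Proof.
move=> /lexltP[k eq_m lt_k]; apply/lexltP; exists k => [i /eq_m|].
  by rewrite !mnmDE => ->.
by rewrite !mnmDE ltn_add2l.
Qed.

Lemma lexlt_irr m : lexlt m m = false. Proof. by rewrite /lexlt eqxx. Qed.

Lemma lexlt_le_trans m2 m1 m3 : lexlt m1 m2 -> lexle m2 m3 -> lexlt m1 m3.
Proof.
move=> /andP[ne12 m12] m23; rewrite /lexlt (lexle_trans m12 m23) andbT.
by apply: contraNneq ne12 => e; rewrite -e in m23; rewrite (lexle_anti m12 m23).
Qed.

Lemma lexle_lt_trans m2 m1 m3 : lexle m1 m2 -> lexlt m2 m3 -> lexlt m1 m3.
Proof.
move=> m12 /andP[ne23 m23]; rewrite /lexlt (lexle_trans m12 m23) andbT.
by apply: contraNneq ne23 => e; rewrite e in m12; rewrite (lexle_anti m23 m12).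
Qed.

Lemma lexle0 m : lexle 0%MM m.
Proof.
have [-> //|m0] := eqVneq 0%MM m; first exact: lexle_refl.
have [//|/= m_le0] := orP (lexle_total 0%MM m).
have /lexltP[k _] : lexlt m 0%MM by rewrite /lexlt eq_sym m0.
by rewrite mnm0E.
Qed.

(** There are finitely many monomials of a given degree, so that the order is well
    founded on them. *)
Lemma lexlt_mdeg_ind (P : 'X_{1..N} -> Prop) :
  (forall m, (forall m', mdeg m' = mdeg m -> lexlt m' m -> P m') -> P m) ->
  forall m, P m.
Proof.
move=> step m; have [k] := ubnP #|[set b : 'X_{1..N < (mdeg m).+1} | lexlt b m]|.
elim: k m => // k IHk m /ltnSE card_m; apply: step => m' deg_m' lt_m'.
apply: IHk; rewrite deg_m'; apply: leq_trans card_m; apply: proper_card.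
have bound_m' : (mdeg m' < (mdeg m).+1)%N by rewrite deg_m'.
apply/properP; split; last by exists (BMultinom bound_m'); rewrite inE /= ?lexlt_irr.
apply/subsetP => b; rewrite !inE => lt_b; apply: lexlt_le_trans lt_b _.
by case/andP: lt_m'.
Qed.

End Lex.

Section Lead.
Variables (K : fieldType) (N : nat).
Implicit Types (f g h : {mpoly K[N]}) (m : 'X_{1..N}) (G : seq {mpoly K[N]}).

Lemma lexlead_max f m : m \in msupp f -> lexle m (lexlead f).
Proof.
rewrite /lexlead; elim: (msupp f) => //= a s IHs; rewrite big_cons /lexmax inE.
set b := \big[_/_]_(j <- s) j in IHs *.
case: ifP => [ab /orP[/eqP -> //|/IHs //]|/negbT ab].
have ba : lexle b a by have := lexle_total a b; rewrite (negbTE ab).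
by move=> /orP[/eqP ->|/IHs mb]; [apply: lexle_refl | apply: lexle_trans mb ba].
Qed.

Lemma lexlead_supp f : f != 0 -> lexlead f \in msupp f.
Proof.
rewrite -msupp_eq0 /lexlead; elim: (msupp f) => //= a s IHs _.
rewrite big_cons /lexmax inE; case: ifP => [ab|_]; last by rewrite eqxx.
have [s0|/IHs ->] := eqVneq s [::]; last by rewrite orbT.
by move: ab; rewrite s0 big_nil => a0; rewrite (lexle_anti a0 (lexle0 a)) eqxx.
Qed.

Lemma lexleadE f m :
  m \in msupp f -> (forall m', m' \in msupp f -> lexle m' m) -> lexlead f = m.
Proof.
move=> mf fm; apply: lexle_anti; last exact: lexlead_max.
apply: fm; apply: lexlead_supp; apply: contraTneq mf => ->.
by rewrite msupp0.
Qed.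

Lemma lexlead_eq f m :
  f@_m = 1 -> (forall m', m' \in msupp f -> m' != m -> lexlt m' m) -> lexlead f = m.
Proof.
move=> fm low; apply: lexleadE => [|m' m'f].
  by rewrite mcoeff_msupp fm oner_neq0.
have [->|/(low _ m'f)/andP[_ //]] := eqVneq m' m; exact: lexle_refl.
Qed.

Lemma ideal_gen0 (B : {mpoly K[N]} -> Prop) : ideal_gen B 0.
Proof. by exists [::] => //; rewrite big_nil. Qed.

Lemma ideal_genM (B : {mpoly K[N]} -> Prop) a f : B f -> ideal_gen B (a * f).
Proof.
by move=> Bf; exists [:: (a, f)]; [move=> z; rewrite inE => /eqP ->|rewrite big_seq1].
Qed.

Lemma ideal_gen_sub (B C : {mpoly K[N]} -> Prop) f :
  (forall g a, B g -> ideal_gen C (a * g)) -> ideal_gen B f -> ideal_gen C f.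
Proof.
move=> BC [s + ->]; elim: s => [|[a g] s IHs] sB.
  by rewrite big_nil; apply: ideal_gen0.
rewrite big_cons /=; have [s1 s1C ->] := BC g a (sB (a, g) (mem_head _ _)).
have [|s2 s2C ->] := IHs; first by move=> z zs; apply: sB; rewrite inE zs orbT.
exists (s1 ++ s2); last by rewrite big_cat.
by move=> z; rewrite mem_cat => /orP[/s1C|/s2C].
Qed.

(** The leading term of f is the multiple of the leading term of g by
    a scalar and a monomial. *)
Lemma groebner_basisP (I : {pred {mpoly K[N]}}) G :
  {subset G <= I} ->
  (forall g, g \in G -> g@_(lexlead g) = 1) ->
  (forall f, f \in I -> f != 0 -> exists2 g, g \in G & (lexlead g <= lexlead f)%MM) ->
  groebner_basis I G.
Proof.
move=> GI monic lead; split=> // f; split; apply: ideal_gen_sub => _ a [h hI ->].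
  have [->|h0] := eqVneq h 0.
    by rewrite /lead_term mcoeff0 scale0r mulr0; apply: ideal_gen0.
  have [g gG le_gh] := lead h hI h0.
  have -> : a * lead_term h =
      a * (h@_(lexlead h) *: 'X_[lexlead h - lexlead g]) * lead_term g.
    by rewrite /lead_term (monic g) // scale1r -mulrA -scalerAl -mpolyXD submK //.
  by apply: ideal_genM; exists g.
by apply: ideal_genM; exists h => //; apply: GI.
Qed.

End Lead.

(** * Monomials in the Pluecker variables as families of arcs *)

Section Arcs.
Variable (n : nat).
Implicit Types (i j k l : 'I_n) (p q : 'I_n * 'I_n) (mu nu : 'X_{1..npairs n}).

(** The multiplicity of the arc (i, j) in the monomial mu. *)
Definition arc_mult mu i j : nat :=
  if insub (i, j) is Some ij then mu (enum_rank (ij : pair_index n)) else 0%N.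

Lemma arc_mult_pair mu (a : pair_index n) :
  arc_mult mu (val a).1 (val a).2 = mu (enum_rank a).
Proof. by rewrite /arc_mult -surjective_pairing valK. Qed.

Lemma arc_mult_lt mu i j : (0 < arc_mult mu i j -> i < j)%N.
Proof. by rewrite /arc_mult; case: insubP => // -[[? ?] /= +] _ [<- <-]. Qed.

Lemma arc_mult_inj mu nu : arc_mult mu =2 arc_mult nu -> mu = nu.
Proof.
move=> eq_mult; apply/mnmP => v; rewrite -(enum_valK v).
by rewrite -!arc_mult_pair eq_mult.
Qed.

Lemma big_pair_index (R : Type) (idx : R) (op : Monoid.com_law idx)
    (F : 'I_n -> 'I_n -> R) :
  \big[op/idx]_(v < npairs n) F (val (enum_val v)).1 (val (enum_val v)).2 =
  \big[op/idx]_(i < n) \big[op/idx]_(j < n) (if (i < j)%N then F i j else idx).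
Proof.
rewrite pair_big -big_mkcond /=.
rewrite (big_sub [pred ij : 'I_n * 'I_n | (ij.1 < ij.2)%N] (fun p => F p.1 p.2)).
by rewrite [RHS](big_enum_val (fun a : pair_index n => F (val a).1 (val a).2)).
Qed.

Lemma arc_mult_enum_val mu v :
  mu v = arc_mult mu (val (enum_val v)).1 (val (enum_val v)).2.
Proof. by rewrite arc_mult_pair enum_valK. Qed.

Lemma arc_count_arc_mult mu : arc_count (arc_mult mu) = mdeg mu.
Proof.
rewrite mdegE [RHS](eq_bigr _ (fun v _ => arc_mult_enum_val mu v)).
rewrite big_pair_index; do 2!apply: eq_bigr => ? _; case: ifP => // /negbT ij.
by apply/eqP; rewrite -leqn0 leqNgt; apply: contra ij; apply: arc_mult_lt.
Qed.

Lemma pluecker_map_mon (K : fieldType) mu :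
  pluecker_map ('X_[mu] : {mpoly K[npairs n]}) = arc_prod K (arc_mult mu).
Proof.
rewrite /pluecker_map comp_mpolyX.
under eq_bigr => v _ do rewrite tnth_mktuple arc_mult_enum_val.
rewrite (big_pair_index _ (fun i j => minor K i j ^+ arc_mult mu i j)).
apply: eq_bigr => i _; apply: eq_bigr => j _; case: ifP => // /negbT ij.
have [->|/arc_mult_lt ij'] := posnP (arc_mult mu i j); first by rewrite expr0.
by rewrite ij' in ij.
Qed.

Definition arc_var p : 'X_{1..npairs n} :=
  if insub p is Some ij then U_(enum_rank (ij : pair_index n))%MM else 0%MM.

Definition arc_mon (s : seq ('I_n * 'I_n)) : 'X_{1..npairs n} :=
  (\sum_(p <- s) arc_var p)%MM.

Lemma arc_mult_arc_var p i j :
  (p.1 < p.2)%N -> (i < j)%N -> arc_mult (arc_var p) i j = (p == (i, j)).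
Proof.
move=> p12 ij; rewrite /arc_var /arc_mult !insubT mnm1E (inj_eq enum_rank_inj).
by rewrite -val_eqE.
Qed.

Lemma arc_mult_arc_mon s i j :
  all (fun p => p.1 < p.2)%N s -> (i < j)%N ->
  arc_mult (arc_mon s) i j = count_mem (i, j) s.
Proof.
move=> /allP sP ij; rewrite -sum1_count big_mkcond /=.
have -> : arc_mult (arc_mon s) i j = (\sum_(p <- s) arc_mult (arc_var p) i j)%N.
  by rewrite /arc_mon /arc_mult insubT mnm_sumE.
rewrite big_seq [RHS]big_seq; apply: eq_bigr => p ps.
by rewrite arc_mult_arc_var ?sP //; case: eqP.
Qed.

Lemma mdeg_arc_mon s :
  all (fun p => p.1 < p.2)%N s -> mdeg (arc_mon s) = size s.
Proof.
move=> /allP sP; rewrite mdeg_sum -sum1_size big_seq [RHS]big_seq.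
by apply: eq_bigr => p /sP p12; rewrite /arc_var insubT mdeg1.
Qed.

Lemma pvarE (K : fieldType) i j : (i < j)%N -> pvar K i j = 'X_[arc_var (i, j)].
Proof. by move=> ij; rewrite /pvar /arc_var insubT. Qed.

(** The variables are numbered by the lexicographic order of the pairs, so
    the arcs before (i, j) are those with smaller start, or the same start and
    smaller end. *)
Lemma lexlt_arc_mult mu nu i j :
  (i < j)%N -> (arc_mult mu i j < arc_mult nu i j)%N ->
  (forall a b : 'I_n, a < b -> (a < i) || (a == i) && (b < j) ->
     arc_mult mu a b = arc_mult nu a b)%N ->
  lexlt mu nu.
Proof.
move=> ij lt_ij eq_before; apply/lexltP.
exists (enum_rank (Sub (i, j) ij : pair_index n)).
  move=> v; rewrite -{1}(enum_valK v) enum_rank_pair_index /= => before.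
  by rewrite !arc_mult_enum_val eq_before //; case: (enum_val v).
by rewrite -!arc_mult_pair.
Qed.

Lemma lem_arc_mult mu nu :
  (forall i j, arc_mult mu i j <= arc_mult nu i j)%N <-> (mu <= nu)%MM.
Proof.
split=> [le|/mnm_lepP le i j]; last by rewrite /arc_mult; case: insubP.
by apply/mnm_lepP => v; rewrite !arc_mult_enum_val.
Qed.

Lemma arc_mon_le s mu :
  uniq s -> (forall p, p \in s -> 0 < arc_mult mu p.1 p.2)%N ->
  (arc_mon s <= mu)%MM.
Proof.
move=> us s_mu; apply/lem_arc_mult => i j.
case: (posnP (arc_mult (arc_mon s) i j)) => [->//|/arc_mult_lt ij].
rewrite arc_mult_arc_mon //; last by apply/allP => p /s_mu /arc_mult_lt.
by rewrite count_uniq_mem //; case: (boolP (_ \in s)) => // /s_mu.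
Qed.

Lemma arc_mon_sub s1 s2 :
  all (fun p => p.1 < p.2)%N s1 -> all (fun p => p.1 < p.2)%N s2 ->
  (arc_mon s1 <= arc_mon s2)%MM -> {subset s1 <= s2}.
Proof.
move=> s1P s2P /lem_arc_mult le [i j] p1; have ij := allP s1P _ p1.
have := le i j; rewrite !arc_mult_arc_mon // -2!has_pred1 !has_count in p1 *.
exact: leq_trans.
Qed.

End Arcs.

(** * Normal forms modulo the Pluecker ideal *)

Section NF.
Variables (K : fieldType) (n : nat).
Implicit Types (f g h : {mpoly K[npairs n]}) (mu nu : 'X_{1..npairs n}).
Local Notation I := (pluecker_ideal K n).

Lemma pluecker_idealP f : reflect (pluecker_map f = 0) (f \in I).
Proof. exact: eqP. Qed.

Lemma pluecker_idealD f g : f \in I -> g \in I -> f + g \in I.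
Proof.
move=> /pluecker_idealP f0 /pluecker_idealP g0; apply/pluecker_idealP.
by rewrite [LHS]raddfD /= -![_ \mPo _]/(pluecker_map _) f0 g0 addr0.
Qed.

Lemma pluecker_idealM f g : g \in I -> f * g \in I.
Proof.
move=> /pluecker_idealP g0; apply/pluecker_idealP.
by rewrite [LHS]rmorphM /= -![_ \mPo _]/(pluecker_map _) g0 mulr0.
Qed.

Lemma pluecker_idealZ c f : f \in I -> c *: f \in I.
Proof. by rewrite -mul_mpolyC; apply: pluecker_idealM. Qed.

Lemma pluecker_ideal0 : 0 \in I.
Proof. by apply/pluecker_idealP; apply: raddf0. Qed.

Lemma pluecker_idealB f g : f \in I -> g \in I -> f - g \in I.
Proof. by move=> fI gI; rewrite -scaleN1r pluecker_idealD ?pluecker_idealZ. Qed.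

(** The image is split into homogeneous components, to which [arc_prod_indep]
    applies. *)
Lemma standard_indep f :
  f \in I -> (forall mu, mu \in msupp f -> standard (arc_mult mu)) -> f = 0.
Proof.
move=> /pluecker_idealP f0 std; apply/eqP; rewrite -msupp_eq0.
apply/eqP; case def_s: (msupp f) => [//|mu s]; exfalso.
have muf : mu \in msupp f by rewrite def_s mem_head.
have sum0 : \sum_(nu <- msupp f) f@_nu *: arc_prod K (arc_mult nu) = 0.
  rewrite -[RHS]f0 [in RHS](mpolyE f) [RHS]raddf_sum; apply: eq_bigr => nu _.
  by rewrite /= linearZ -pluecker_map_mon.
pose d := mdeg mu.
have sumd : \sum_(nu <- [seq nu <- msupp f | mdeg nu == d])
    f@_nu *: arc_prod K (arc_mult nu) = 0.
  have := congr1 (@pihomog _ K mdeg (2 * d)) sum0.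
  rewrite raddf0 raddf_sum => pi0; rewrite -[RHS]pi0 big_filter big_mkcond.
  apply: eq_bigr => nu _; rewrite /= linearZ /=.
  have hom := arc_prod_homog K (arc_count_arc_mult nu).
  case: ifP => [/eqP nud|/negbT nud]; first by rewrite pihomog_dE // -nud.
  by rewrite (pihomog_ne0 _ hom) ?scaler0 // eqn_pmul2l.
have : f@_mu = 0.
  apply: (@arc_prod_indep _ _ _ d n 0 _ _ _ _ _ _ _ _ _ sumd mu) => //.
  - by rewrite filter_uniq // msupp_uniq.
  - by move=> nu _ i j /arc_mult_lt.
  - by move=> nu; rewrite mem_filter => /andP[_]; apply: std.
  - by move=> nu; rewrite mem_filter => /andP[/eqP <- _]; apply: arc_count_arc_mult.
  - by move=> nu1 nu2 _ _; apply: arc_mult_inj.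
  - by rewrite mem_filter eqxx.
by apply/eqP; rewrite -mcoeff_msupp.
Qed.

(** The monomial mu is divisible by the leading monomial of a homogeneous monic
    element of the ideal. *)
Definition reducible mu : Prop :=
  exists g nu,
  [/\ g \in I, g@_nu = 1, (nu <= mu)%MM
    & forall nu', nu' \in msupp g -> nu' != nu -> mdeg nu' = mdeg nu /\ lexlt nu' nu].

Lemma normal_form_lin (P : 'X_{1..npairs n} -> Prop) f :
  (forall mu, mu \in msupp f ->
     exists2 h, 'X_[mu] - h \in I & forall nu, nu \in msupp h -> P nu) ->
  exists2 h, f - h \in I & forall nu, nu \in msupp h -> P nu.
Proof.
rewrite {2}(mpolyE f); elim: (msupp f) => [|mu s IHs] nf.
  by exists 0 => [|nu]; rewrite ?msupp0 // big_nil subrr pluecker_ideal0.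
have [|h1 h1I h1P] := nf mu; first exact: mem_head.
have [|h2 h2I h2P] := IHs; first by move=> nu nus; apply: nf; rewrite inE nus orbT.
exists (f@_mu *: h1 + h2) => [|nu /msuppD_le].
  rewrite big_cons opprD addrACA -scalerBr.
  by rewrite pluecker_idealD // pluecker_idealZ.
by rewrite mem_cat => /orP[/msuppZ_le/h1P|/h2P].
Qed.

(** Subtracting a multiple of g replaces a reducible monomial by monomials of the
    same degree that are lexicographically smaller. *)
Lemma normal_form mu :
  (forall nu, standard (arc_mult nu) \/ reducible nu) ->
  exists2 h, 'X_[mu] - h \in I
    & forall nu, nu \in msupp h -> standard (arc_mult nu) /\ lexle nu mu.
Proof.
move=> dichotomy; elim/lexlt_mdeg_ind: mu => mu IHmu.
have [std|[g [lam [gI g1 lam_mu low]]]] := dichotomy mu.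
  exists 'X_[mu]; first by rewrite subrr pluecker_ideal0.
  by move=> nu; rewrite msuppX inE => /eqP ->; split=> //; apply: lexle_refl.
(* One step of reduction by g. *)
pose f := 'X_[mu] - 'X_[mu - lam] * g.
have f_low nu : nu \in msupp f -> mdeg nu = mdeg mu /\ lexlt nu mu.
  move=> nuf; have nu_mu : nu != mu.
    apply: contraTneq nuf => ->; rewrite mcoeff_msupp negbK mcoeffB mcoeffX eqxx.
    by rewrite mulrC -[X in _ - _@_X](submK lam_mu) mcoeffMX g1 subrr.
  move: nuf => /msuppB_le; rewrite mem_cat msuppX inE (negbTE nu_mu) /=.
  move=> /msuppM_le/allpairsP[[a b]] /=; rewrite msuppX inE => -[/eqP -> bg nuE].
  have b_lam : b != lam by apply: contraNneq nu_mu => b_lam; rewrite nuE b_lam submK.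
  have [degb lex_b] := low b bg b_lam.
  rewrite nuE mdegD degb -mdegD submK //; split=> //.
  by rewrite -{2}(submK lam_mu) lexlt_add.
have [h hI hP] : exists2 h, f - h \in I
    & forall nu, nu \in msupp h -> standard (arc_mult nu) /\ lexle nu mu.
  apply: normal_form_lin => nu /f_low[deg_nu lt_nu].
  have [h hI hP] := IHmu nu deg_nu lt_nu.
  exists h => // nu' /hP[std' le']; split=> //.
  by apply: lexle_trans le' _; case/andP: lt_nu.
exists h => //; have -> : 'X_[mu] - h = f - h + 'X_[mu - lam] * g.
  by rewrite /f; ring.
by rewrite pluecker_idealD // pluecker_idealM.
Qed.

(** All monomials of f but the leading one are brought into normal form; the
    leading one survives, against [standard_indep]. *)
Lemma lexlead_not_standard f :
  (forall nu, standard (arc_mult nu) \/ reducible nu) ->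
  f \in I -> f != 0 -> ~ standard (arc_mult (lexlead f)).
Proof.
move=> dichotomy fI f0 std; pose mu := lexlead f.
have [h hI hP] : exists2 h, f - f@_mu *: 'X_[mu] - h \in I
    & forall nu, nu \in msupp h -> standard (arc_mult nu) /\ lexlt nu mu.
  apply: normal_form_lin => nu nuf.
  have nu_mu : nu != mu.
    apply: contraTneq nuf => ->; rewrite mcoeff_msupp negbK.
    by rewrite mcoeffB mcoeffZ mcoeffX eqxx mulr1 subrr.
  have lt_nu : lexlt nu mu.
    rewrite /lexlt nu_mu /=; apply: lexlead_max.
    move/msuppB_le: nuf; rewrite mem_cat => /orP[//|/msuppZ_le].
    by rewrite msuppX inE (negbTE nu_mu).
  have [h hI hP] := normal_form nu dichotomy.
  exists h => // nu' /hP[std' le']; split=> //; exact: lexle_lt_trans lt_nu.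
have h0 : f@_mu *: 'X_[mu] + h = 0.
  apply: standard_indep => [|nu /msuppD_le].
    have -> : f@_mu *: 'X_[mu] + h = f - (f - f@_mu *: 'X_[mu] - h) by ring.
    exact: pluecker_idealB.
  rewrite mem_cat => /orP[/msuppZ_le|/hP[] //].
  by rewrite msuppX inE => /eqP ->.
have := congr1 (mcoeff mu) h0; rewrite mcoeffD mcoeffZ mcoeffX eqxx mulr1 mcoeff0.
rewrite (memN_msupp_eq0 (p := h)) ?addr0; last first.
  by apply/negP => /hP[_]; rewrite lexlt_irr.
by apply/eqP; rewrite -mcoeff_msupp lexlead_supp.
Qed.
End NF.

(** * Arcs of the leading monomials *)

Section Comb.
Variable (n : nat).
Implicit Types (p q r : 'I_n * 'I_n) (s t : seq ('I_n * 'I_n)).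

Definition arcs s := all (fun p => p.1 < p.2)%N s.

(** The arcs of a leading monomial: two successive disjoint arcs, or a chain of
    three with r.1 <= p.2, where equality is the case of a five-index cubic. *)
Definition is_lead s : bool :=
  match s with
  | [:: p; q] => [&& p.1 < p.2, p.2 < q.1 & q.1 < q.2]%N
  | [:: p; q; r] => [&& p.1 < q.1, q.1 < r.1, r.1 <= p.2, p.2 < q.2 & q.2 < r.2]%N
  | _ => false
  end.

Lemma is_lead_arcs s : is_lead s -> arcs s.
Proof. by case: s => [|[? ?] [|[? ?] [|[? ?] []]]] //=; lia. Qed.

(** The leading monomials are squarefree, so that divisibility between them is
    inclusion of the sets of arcs. A cubic one has no two disjoint arcs, and a
    chain determines the order in which its arcs are listed. *)
Lemma is_lead_sub s t : is_lead s -> is_lead t -> {subset s <= t} -> s = t.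
Proof.
move=> s_lead t_lead st.
have {}st p : p \in s -> p \in t by apply: st.
case: s s_lead st => [|[p1 p2] [|[q1 q2] [|[r1 r2] []]]] //= s_lead st;
case: t t_lead st => [|[p1' p2'] [|[q1' q2'] [|[r1' r2'] []]]] //= t_lead st.
- have := st (p1, p2); have := st (q1, q2).
  rewrite !inE !xpair_eqE !eqxx ?orbT /= => /(_ isT) Hq /(_ isT) Hp.
  have : [&& p1 == p1', p2 == p2', q1 == q1' & q2 == q2'].
    move: Hp Hq; rewrite -!val_eqE /=; lia.
  by move=> /and4P[/eqP-> /eqP-> /eqP-> /eqP->].
- have := st (p1, p2); have := st (q1, q2).
  rewrite !inE !xpair_eqE !eqxx ?orbT /= => /(_ isT) Hq /(_ isT) Hp.
  by exfalso; move: Hp Hq; rewrite -!val_eqE /=; lia.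
- have := st (p1, p2); have := st (q1, q2); have := st (r1, r2).
  rewrite !inE !xpair_eqE !eqxx ?orbT /= => /(_ isT) Hr /(_ isT) Hq /(_ isT) Hp.
  by exfalso; move: Hp Hq Hr; rewrite -!val_eqE /=; lia.
- have := st (p1, p2); have := st (q1, q2); have := st (r1, r2).
  rewrite !inE !xpair_eqE !eqxx ?orbT /= => /(_ isT) Hr /(_ isT) Hq /(_ isT) Hp.
  have : [&& p1 == p1', p2 == p2', q1 == q1' & q2 == q2'] && ((r1 == r1') && (r2 == r2')).
    move: Hp Hq Hr; rewrite -!val_eqE /=; lia.
  by move=> /andP[/and4P[/eqP-> /eqP-> /eqP-> /eqP->] /andP[/eqP-> /eqP->]].
Qed.

(** No leading monomial divides the monomial with arcs t. *)
Definition lead_free t := forall s, is_lead s -> ~ {subset s <= t}.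

Lemma lead_freeP t :
  (forall p1 p2 q1 q2 : 'I_n, is_lead [:: (p1, p2); (q1, q2)] ->
     (p1, p2) \in t -> (q1, q2) \in t -> False) ->
  (forall p1 p2 q1 q2 r1 r2 : 'I_n, is_lead [:: (p1, p2); (q1, q2); (r1, r2)] ->
     (p1, p2) \in t -> (q1, q2) \in t -> (r1, r2) \in t -> False) ->
  lead_free t.
Proof.
move=> free2 free3 [|[p1 p2] [|[q1 q2] [|[r1 r2] []]]] // s_lead st.
  by apply: free2 s_lead _ _; apply: st; rewrite !inE eqxx ?orbT.
by apply: free3 s_lead _ _ _; apply: st; rewrite !inE eqxx ?orbT.
Qed.

Ltac lead_free_lia :=
  apply: lead_freeP => ? ? ? ?; [|move=> ? ?];
  rewrite !inE !xpair_eqE -!val_eqE /=; lia.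

Lemma quadric_tails_lead_free (i j k l : 'I_n) :
  (i < j < k)%N -> (k < l)%N ->
  lead_free [:: (i, k); (j, l)] /\ lead_free [:: (i, l); (j, k)].
Proof. by move=> ijk kl; split; lead_free_lia. Qed.

Lemma cubic5_tails_lead_free (i j k l m : 'I_n) :
  (i < j < k)%N -> (k < l < m)%N ->
  [/\ lead_free [:: (i, k); (j, m); (k, l)],
      lead_free [:: (i, l); (j, k); (k, m)]
    & lead_free [:: (i, m); (j, k); (k, l)]].
Proof. by move=> ijk klm; split; lead_free_lia. Qed.

Lemma cubic6_tails_lead_free (i j k l m s : 'I_n) :
  (i < j < k)%N -> (k < l < m)%N -> (m < s)%N ->
  [/\ lead_free [:: (i, l); (j, s); (k, m)],
      lead_free [:: (i, m); (j, l); (k, s)],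
      lead_free [:: (i, m); (j, s); (k, l)],
      lead_free [:: (i, s); (j, l); (k, m)]
    & lead_free [:: (i, s); (j, m); (k, l)]].
Proof. by move=> ijk klm ms; split; lead_free_lia. Qed.

(** The arc (i, j) is the first at which the two monomials differ. *)
Lemma lexlt_arc_mon s t (i j : 'I_n) :
  arcs s -> arcs t -> (i < j)%N ->
  (count_mem (i, j) t < count_mem (i, j) s)%N ->
  (forall a b : 'I_n, (a < i) || (a == i) && (b < j) ->
     count_mem (a, b) t = count_mem (a, b) s)%N ->
  lexlt (arc_mon t) (arc_mon s).
Proof.
move=> sA tA ij lt_ij before; apply: (lexlt_arc_mult ij); rewrite ?arc_mult_arc_mon //.
by move=> a b ab /before; rewrite !arc_mult_arc_mon.
Qed.

Ltac lexlt_lia i j :=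
  apply: (@lexlt_arc_mon _ _ i j);
  [ rewrite /arcs /=; lia | rewrite /arcs /=; lia | lia
  | rewrite /= !xpair_eqE -!val_eqE /=; lia
  | move=> a b; rewrite /= !xpair_eqE -!val_eqE /=; lia ].

Lemma quadric_tails_lexlt (i j k l : 'I_n) :
  (i < j < k)%N -> (k < l)%N ->
  lexlt (arc_mon [:: (i, k); (j, l)]) (arc_mon [:: (i, j); (k, l)]) /\
  lexlt (arc_mon [:: (i, l); (j, k)]) (arc_mon [:: (i, j); (k, l)]).
Proof. by move=> ijk kl; split; lexlt_lia i j. Qed.

Lemma cubic5_tails_lexlt (i j k l m : 'I_n) :
  (i < j < k)%N -> (k < l < m)%N ->
  let s := [:: (i, k); (j, l); (k, m)] in
  [/\ lexlt (arc_mon [:: (i, k); (j, m); (k, l)]) (arc_mon s),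
      lexlt (arc_mon [:: (i, l); (j, k); (k, m)]) (arc_mon s)
    & lexlt (arc_mon [:: (i, m); (j, k); (k, l)]) (arc_mon s)].
Proof. by move=> ijk klm s; split; [lexlt_lia j l|lexlt_lia i k|lexlt_lia i k]. Qed.

Lemma cubic6_tails_lexlt (i j k l m s : 'I_n) :
  (i < j < k)%N -> (k < l < m)%N -> (m < s)%N ->
  let u := [:: (i, l); (j, m); (k, s)] in
  [/\ lexlt (arc_mon [:: (i, l); (j, s); (k, m)]) (arc_mon u),
      lexlt (arc_mon [:: (i, m); (j, k); (l, s)]) (arc_mon u)
    & lexlt (arc_mon [:: (i, s); (j, k); (l, m)]) (arc_mon u)].
Proof. by move=> ijk klm ms u; split; [lexlt_lia j m|lexlt_lia i l|lexlt_lia i l]. Qed.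

Lemma cubic6_reduced_tails_lexlt (i j k l m s : 'I_n) :
  (i < j < k)%N -> (k < l < m)%N -> (m < s)%N ->
  let u := [:: (i, l); (j, m); (k, s)] in
  [/\ lexlt (arc_mon [:: (i, l); (j, s); (k, m)]) (arc_mon u),
      lexlt (arc_mon [:: (i, m); (j, l); (k, s)]) (arc_mon u),
      lexlt (arc_mon [:: (i, m); (j, s); (k, l)]) (arc_mon u),
      lexlt (arc_mon [:: (i, s); (j, l); (k, m)]) (arc_mon u)
    & lexlt (arc_mon [:: (i, s); (j, m); (k, l)]) (arc_mon u)].
Proof.
by move=> ijk klm ms u; split;
  [lexlt_lia j m|lexlt_lia i l|lexlt_lia i l|lexlt_lia i l|lexlt_lia i l].
Qed.

End Comb.

(** * The quadrics and cubics *)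

Section Gen.
Variables (K : fieldType) (n : nat).
Implicit Types (i j k l m r : 'I_n) (s t u : seq ('I_n * 'I_n)).
Implicit Types (f g h : {mpoly K[npairs n]}).
Local Notation I := (pluecker_ideal K n).

Lemma pluecker_map_pvar i j :
  (i < j)%N -> pluecker_map (pvar K i j) = minor K i j.
Proof.
move=> ij; rewrite /pluecker_map /pvar insubT comp_mpolyXU -tnth_nth.
by rewrite tnth_mktuple enum_rankK.
Qed.

Lemma quadric_in_ideal i j k l :
  (i < j < k)%N -> (k < l)%N -> quadric K i j k l \in I.
Proof.
move=> ijk kl; apply/pluecker_idealP.
rewrite /pluecker_map /quadric rmorphD rmorphB !rmorphM /=.
rewrite -![_ \mPo _]/(pluecker_map _) !pluecker_map_pvar; try lia.
by rewrite /minor; ring.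
Qed.

Lemma cubic5_in_ideal i j k l m :
  (i < j < k)%N -> (k < l < m)%N -> cubic5 K i j k l m \in I.
Proof.
move=> ijk klm; apply/pluecker_idealP.
rewrite /pluecker_map /cubic5 rmorphD !rmorphB !rmorphM /=.
rewrite -![_ \mPo _]/(pluecker_map _) !pluecker_map_pvar; try lia.
by rewrite /minor; ring.
Qed.

Lemma cubic6_in_ideal i j k l m r :
  (i < j < k)%N -> (k < l < m)%N -> (m < r)%N -> cubic6 K i j k l m r \in I.
Proof.
move=> ijk klm ms; apply/pluecker_idealP.
rewrite /pluecker_map /cubic6 rmorphD !rmorphB !rmorphM /=.
rewrite -![_ \mPo _]/(pluecker_map _) !pluecker_map_pvar; try lia.
by rewrite /minor; ring.
Qed.

(** f is homogeneous with leading monomial s and leading coefficient 1; L lists the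
    remaining terms. *)
Definition expansion f s (L : seq (K * seq ('I_n * 'I_n))) : Prop :=
  f = 'X_[arc_mon s] + \sum_(ct <- L) ct.1 *: 'X_[arc_mon ct.2] /\
  all (fun ct => [&& arcs ct.2, size ct.2 == size s
                   & lexlt (arc_mon ct.2) (arc_mon s)]) L.

Lemma expansion_coef f s L : expansion f s L -> f@_(arc_mon s) = 1.
Proof.
move=> [-> /allP LP]; rewrite mcoeffD mcoeffX eqxx raddf_sum /= big_seq big1 ?addr0 //.
move=> ct /LP/and3P[_ _ /andP[ne _]].
by rewrite mcoeffZ mcoeffX (negbTE ne) mulr0.
Qed.

Lemma expansion_supp f s L mu :
  expansion f s L -> mu \in msupp f -> mu != arc_mon s ->
  exists2 ct, ct \in L & mu = arc_mon ct.2.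
Proof.
move=> [-> _] /msuppD_le; rewrite mem_cat msuppX inE => /orP[->//|].
move=> /msupp_sum_le/flatten_mapP[ct]; rewrite mem_filter /= => ctL.
by move=> /msuppZ_le; rewrite msuppX inE => /eqP -> _; exists ct.
Qed.

Lemma expansion_low f s L mu :
  arcs s -> expansion f s L -> mu \in msupp f -> mu != arc_mon s ->
  mdeg mu = mdeg (arc_mon s) /\ lexlt mu (arc_mon s).
Proof.
move=> sA fL muf mu_s; have [ct ctL ->] := expansion_supp fL muf mu_s.
have /and3P[tA /eqP sz lt] := allP fL.2 _ ctL.
by rewrite !mdeg_arc_mon // sz.
Qed.

Lemma expansion_lexlead f s L : expansion f s L -> lexlead f = arc_mon s.
Proof.
move=> fL; apply: lexlead_eq (expansion_coef fL) _ => mu muf mu_s.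
have [ct ctL ->] := expansion_supp fL muf mu_s.
by have /and3P[] := allP fL.2 _ ctL.
Qed.

Lemma expansion_lead_term f s L : expansion f s L -> lead_term f = 'X_[arc_mon s].
Proof.
by move=> fL; rewrite /lead_term (expansion_lexlead fL) (expansion_coef fL) scale1r.
Qed.

Lemma arc_mon_pvar2 i j k l : (i < j)%N -> (k < l)%N ->
  'X_[arc_mon [:: (i, j); (k, l)]] = pvar K i j * pvar K k l.
Proof.
by move=> ij kl; rewrite !pvarE // -mpolyXD /arc_mon !big_cons big_nil addm0.
Qed.

Lemma arc_mon_pvar3 i j k l m r : (i < j)%N -> (k < l)%N -> (m < r)%N ->
  'X_[arc_mon [:: (i, j); (k, l); (m, r)]] = pvar K i j * pvar K k l * pvar K m r.
Proof.
move=> ij kl mr; rewrite !pvarE // -!mpolyXD /arc_mon !big_cons big_nil addm0.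
by rewrite addmA.
Qed.

Lemma quadric_expansion i j k l :
  (i < j < k)%N -> (k < l)%N ->
  expansion (quadric K i j k l) [:: (i, j); (k, l)]
    [:: (-1, [:: (i, k); (j, l)]); (1, [:: (i, l); (j, k)])].
Proof.
move=> ijk kl; have [lt1 lt2] := quadric_tails_lexlt ijk kl; split; last first.
  by rewrite /= lt1 lt2 /arcs /=; lia.
rewrite !big_cons big_nil /= ?scaleN1r ?scale1r !arc_mon_pvar2; try lia.
by rewrite /quadric; ring.
Qed.

Lemma cubic5_expansion i j k l m :
  (i < j < k)%N -> (k < l < m)%N ->
  expansion (cubic5 K i j k l m) [:: (i, k); (j, l); (k, m)]
    [:: (-1, [:: (i, k); (j, m); (k, l)]); (-1, [:: (i, l); (j, k); (k, m)]);
        (1, [:: (i, m); (j, k); (k, l)])].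
Proof.
move=> ijk klm; have [lt1 lt2 lt3] := cubic5_tails_lexlt ijk klm; split; last first.
  by rewrite /= lt1 lt2 lt3 /arcs /=; lia.
rewrite !big_cons big_nil /= ?scaleN1r ?scale1r !arc_mon_pvar3; try lia.
by rewrite /cubic5; ring.
Qed.

Lemma cubic6_expansion i j k l m r :
  (i < j < k)%N -> (k < l < m)%N -> (m < r)%N ->
  expansion (cubic6 K i j k l m r) [:: (i, l); (j, m); (k, r)]
    [:: (-1, [:: (i, l); (j, r); (k, m)]); (-1, [:: (i, m); (j, k); (l, r)]);
        (1, [:: (i, r); (j, k); (l, m)])].
Proof.
move=> ijk klm mr; have [lt1 lt2 lt3] := cubic6_tails_lexlt ijk klm mr.
split; last by rewrite /= lt1 lt2 lt3 /arcs /=; lia.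
rewrite !big_cons big_nil /= ?scaleN1r ?scale1r !arc_mon_pvar3; try lia.
by rewrite /cubic6; ring.
Qed.

Lemma cubic6_tail_reduced_expansion i j k l m r :
  (i < j < k)%N -> (k < l < m)%N -> (m < r)%N ->
  expansion (cubic6_tail_reduced K i j k l m r) [:: (i, l); (j, m); (k, r)]
    [:: (-1, [:: (i, l); (j, r); (k, m)]); (-1, [:: (i, m); (j, l); (k, r)]);
        (1, [:: (i, m); (j, r); (k, l)]); (1, [:: (i, r); (j, l); (k, m)]);
        (-1, [:: (i, r); (j, m); (k, l)])].
Proof.
move=> ijk klm mr; have [lt1 lt2 lt3 lt4 lt5] := cubic6_reduced_tails_lexlt ijk klm mr.
split; last by rewrite /= lt1 lt2 lt3 lt4 lt5 /arcs /=; lia.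
rewrite !big_cons big_nil /= ?scaleN1r ?scale1r !arc_mon_pvar3; try lia.
by rewrite cubic6_tail_reducedE; ring.
Qed.

(** The generator with leading arcs s. It is parametrized by the six-index cubics,
    because the minimal and the reduced basis differ in them only. *)
Definition generator
    (C6 : 'I_n -> 'I_n -> 'I_n -> 'I_n -> 'I_n -> 'I_n -> {mpoly K[npairs n]}) s :=
  match s with
  | [:: (i, j); (k, l)] => quadric K i j k l
  | [:: (i, l); (j, m); (k, r)] =>
      if k == l then cubic5 K i j k m r else C6 i j k l m r
  | _ => 0
  end.

Local Notation gen := (generator (@cubic6 K n)).
Local Notation red := (generator (@cubic6_tail_reduced K n)).

Variant lead_spec : seq ('I_n * 'I_n) -> Prop :=
  | Lead4 i j k l of (i < j < k)%N & (k < l)%N : lead_spec [:: (i, j); (k, l)]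
  | Lead5 i j k l m of (i < j < k)%N & (k < l < m)%N :
      lead_spec [:: (i, k); (j, l); (k, m)]
  | Lead6 i j k l m r of (i < j < k)%N & (k < l < m)%N & (m < r)%N :
      lead_spec [:: (i, l); (j, m); (k, r)].

Lemma leadP s : is_lead s -> lead_spec s.
Proof.
case: s => [|[i j] [|[k l] [|[a b] []]]] //= s_lead.
  by apply: Lead4; lia.
have [e|ne] := eqVneq a j; first by subst a; apply: Lead5; lia.
by apply: Lead6; move: ne; rewrite -?val_eqE /=; lia.
Qed.

Lemma generator5 C6 i j k l m :
  generator C6 [:: (i, k); (j, l); (k, m)] = cubic5 K i j k l m.
Proof. by rewrite /= eqxx. Qed.
Lemma generator6 C6 i j k l m r :
  (k < l)%N -> generator C6 [:: (i, l); (j, m); (k, r)] = C6 i j k l m r.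
Proof. by move=> kl; rewrite /= -val_eqE ltn_eqF. Qed.

Lemma gen_expansion s : is_lead s -> exists L, expansion (gen s) s L.
Proof.
move=> /leadP[{s} i j k l ijk kl|{s} i j k l m ijk klm|{s} i j k l m r ijk klm mr].
- by eexists; apply: quadric_expansion.
- by rewrite generator5; eexists; apply: cubic5_expansion.
- by rewrite generator6; [eexists; apply: cubic6_expansion|lia].
Qed.

Lemma red_expansion s : is_lead s ->
  exists2 L, expansion (red s) s L & forall ct, ct \in L -> lead_free ct.2.
Proof.
have free1 (L : seq (K * seq ('I_n * 'I_n))) t c :
    lead_free t -> (forall ct, ct \in L -> lead_free ct.2) ->
    forall ct, ct \in (c, t) :: L -> lead_free ct.2.
  by move=> tF LF ct; rewrite inE => /orP[/eqP ->|/LF].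
have free0 ct : ct \in ([::] : seq (K * seq ('I_n * 'I_n))) -> lead_free ct.2 by [].
move=> /leadP[{s} i j k l ijk kl|{s} i j k l m ijk klm|{s} i j k l m r ijk klm mr].
- have [F1 F2] := quadric_tails_lead_free ijk kl.
  by eexists; [apply: quadric_expansion | do !apply: (free1)].
- have [F1 F2 F3] := cubic5_tails_lead_free ijk klm.
  by rewrite generator5; eexists; [apply: cubic5_expansion | do !apply: (free1)].
- have [F1 F2 F3 F4 F5] := cubic6_tails_lead_free ijk klm mr.
  rewrite generator6; last lia.
  by eexists; [apply: cubic6_tail_reduced_expansion | do !apply: (free1)].
Qed.

Lemma gen_in_ideal s : is_lead s -> gen s \in I.
Proof.
move=> /leadP[{s} i j k l ijk kl|{s} i j k l m ijk klm|{s} i j k l m r ijk klm mr].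
- exact: quadric_in_ideal.
- by rewrite generator5 cubic5_in_ideal.
- by rewrite generator6 ?cubic6_in_ideal //; lia.
Qed.

Lemma red_in_ideal s : is_lead s -> red s \in I.
Proof.
move=> /leadP[{s} i j k l ijk kl|{s} i j k l m ijk klm|{s} i j k l m r ijk klm mr].
- exact: quadric_in_ideal.
- by rewrite generator5 cubic5_in_ideal.
- rewrite generator6; last lia.
  apply: pluecker_idealB; first apply: pluecker_idealD.
  + exact: cubic6_in_ideal.
  + by apply/pluecker_idealM/quadric_in_ideal; lia.
  + by apply/pluecker_idealM/quadric_in_ideal; lia.
Qed.

(** Three successive arcs of a monomial without disjoint arcs satisfy i3 <= j1, so
    they are the arcs of a leading cubic. *)
Lemma lead_dichotomy (mu : 'X_{1..npairs n}) :
  standard (arc_mult mu) \/ exists2 s, is_lead s & (arc_mon s <= mu)%MM.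
Proof.
pose bad2 := [exists p : 'I_n * 'I_n, exists q : 'I_n * 'I_n,
  [&& 0 < arc_mult mu p.1 p.2, 0 < arc_mult mu q.1 q.2, p.2 < q.1 & q.1 < q.2]%N].
pose bad3 := [exists p : 'I_n * 'I_n, exists q : 'I_n * 'I_n, exists r : 'I_n * 'I_n,
  [&& 0 < arc_mult mu p.1 p.2, 0 < arc_mult mu q.1 q.2, 0 < arc_mult mu r.1 r.2,
      p.1 < q.1 < r.1, r.1 <= p.2 & p.2 < q.2 < r.2]%N].
have [/existsP[p /existsP[q /and4P[mup muq pq qq]]]|no2] := boolP bad2.
  right; exists [:: p; q].
    by rewrite /= (arc_mult_lt mup) pq qq.
  apply: arc_mon_le => [|p']; last by rewrite !inE => /orP[]/eqP ->.
  rewrite /= inE andbT; apply: contraTneq pq => ->.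
  by rewrite -leqNgt ltnW.
have {}no2 i j k l :
    (0 < arc_mult mu i j -> 0 < arc_mult mu k l -> i < k -> j < l -> k <= j)%N.
  move=> muij mukl ik jl; rewrite leqNgt; apply: contraNN no2 => jk.
  apply/existsP; exists (i, j); apply/existsP; exists (k, l).
  by rewrite /= muij mukl jk (arc_mult_lt mukl).
have [/existsP[p /existsP[q /existsP[r]]]|no3] := boolP bad3.
  move=> /and5P[mup muq mur /andP[pq qr] /and3P[rp pq2 qr2]].
  right; exists [:: p; q; r]; first by rewrite /= pq qr rp pq2 qr2.
  apply: arc_mon_le => [|p']; last by rewrite !inE => /or3P[]/eqP ->.
  rewrite /= !inE andbT negb_or -andbA; apply/and3P; split.
  - by apply: contraTneq pq => ->; rewrite ltnn.
  - by apply: contraTneq (ltn_trans pq qr) => ->; rewrite ltnn.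
  - by apply: contraTneq qr => ->; rewrite ltnn.
left; split=> // i1 j1 i2 j2 i3 j3 mu1 mu2 mu3 i123.
apply: contraNN no3 => j123.
apply/existsP; exists (i1, j1); apply/existsP; exists (i2, j2).
apply/existsP; exists (i3, j3).
rewrite /= mu1 mu2 mu3 i123 j123 /= andbT.
by have := no2 _ _ _ _ mu1 mu3; lia.
Qed.

Lemma lead_divides f : f \in I -> f != 0 ->
  exists2 s, is_lead s & (arc_mon s <= lexlead f)%MM.
Proof.
move=> fI f0; have [std|//] := lead_dichotomy (lexlead f).
exfalso; apply: (lexlead_not_standard _ fI f0) std => nu.
have [|[s s_lead s_nu]] := lead_dichotomy nu; [by left | right].
have [L fL] := gen_expansion s_lead.
exists (gen s), (arc_mon s); split=> //; first exact: gen_in_ideal.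
  exact: expansion_coef fL.
by move=> mu; apply: expansion_low fL; apply: is_lead_arcs.
Qed.

End Gen.

(** * The generators as lists *)

Section Fin.
Variables (K : fieldType) (n : nat).
Implicit Types (i j k l m r : 'I_n) (s t u : seq ('I_n * 'I_n)).
Implicit Types (f g h : {mpoly K[npairs n]}).
Local Notation I := (pluecker_ideal K n).

Lemma increasing_lt d (t : d.-tuple 'I_n) (a b : 'I_d) :
  t \in increasing n d -> (a < b)%N -> (tnth t a < tnth t b)%N.
Proof.
rewrite inE => t_sorted ab.
have nthE (c : 'I_d) : nth 0%N (map val t) c = tnth t c.
  by rewrite (nth_map (tnth t c)) ?size_tuple // -tnth_nth.
rewrite -!nthE; apply: (sorted_ltn_nth ltn_trans 0%N t_sorted) ab;
  by rewrite inE size_map size_tuple.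
Qed.

Definition lead4 (t : 4.-tuple 'I_n) :=
  [:: (tnth t 0, tnth t 1); (tnth t 2, tnth t 3)].
Definition lead5 (t : 5.-tuple 'I_n) :=
  [:: (tnth t 0, tnth t 2); (tnth t 1, tnth t 3); (tnth t 2, tnth t 4)].
Definition lead6 (t : 6.-tuple 'I_n) :=
  [:: (tnth t 0, tnth t 3); (tnth t 1, tnth t 4); (tnth t 2, tnth t 5)].

Lemma lead4P (t : 4.-tuple 'I_n) : t \in increasing n 4 -> is_lead (lead4 t).
Proof.
by move=> t_incr; rewrite /= !(increasing_lt t_incr).
Qed.

Lemma lead5P (t : 5.-tuple 'I_n) : t \in increasing n 5 -> is_lead (lead5 t).
Proof. by move=> t_incr; rewrite /= leqnn !(increasing_lt t_incr). Qed.

Lemma lead6P (t : 6.-tuple 'I_n) : t \in increasing n 6 -> is_lead (lead6 t).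
Proof.
move=> t_incr; have lt23 := increasing_lt t_incr (a := 2) (b := 3) isT.
by rewrite /= (ltnW lt23) !(increasing_lt t_incr).
Qed.

Lemma lead4_inj : injective lead4.
Proof.
move=> t u [e0 e1 e2 e3]; apply: eq_from_tnth => -[[|[|[|[|//]]]] lt].
- by rewrite (_ : Ordinal lt = 0) //; apply: val_inj.
- by rewrite (_ : Ordinal lt = 1) //; apply: val_inj.
- by rewrite (_ : Ordinal lt = 2) //; apply: val_inj.
- by rewrite (_ : Ordinal lt = 3) //; apply: val_inj.
Qed.

Lemma lead5_inj : injective lead5.
Proof.
move=> t u [e0 e2 e1 e3 _ e4]; apply: eq_from_tnth => -[[|[|[|[|[|//]]]]] lt].
- by rewrite (_ : Ordinal lt = 0) //; apply: val_inj.
- by rewrite (_ : Ordinal lt = 1) //; apply: val_inj.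
- by rewrite (_ : Ordinal lt = 2) //; apply: val_inj.
- by rewrite (_ : Ordinal lt = 3) //; apply: val_inj.
- by rewrite (_ : Ordinal lt = 4) //; apply: val_inj.
Qed.

Lemma lead6_inj : injective lead6.
Proof.
move=> t u [e0 e3 e1 e4 e2 e5]; apply: eq_from_tnth => -[[|[|[|[|[|[|//]]]]]] lt].
- by rewrite (_ : Ordinal lt = 0) //; apply: val_inj.
- by rewrite (_ : Ordinal lt = 1) //; apply: val_inj.
- by rewrite (_ : Ordinal lt = 2) //; apply: val_inj.
- by rewrite (_ : Ordinal lt = 3) //; apply: val_inj.
- by rewrite (_ : Ordinal lt = 4) //; apply: val_inj.
- by rewrite (_ : Ordinal lt = 5) //; apply: val_inj.
Qed.

Section C6.
Variable C6 : 'I_n -> 'I_n -> 'I_n -> 'I_n -> 'I_n -> 'I_n -> {mpoly K[npairs n]}.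
Local Notation gen := (generator C6).

(** Both [cubics6] and [cubics6_tail_reduced] are of this form. *)
Definition cubics6_of : seq {mpoly K[npairs n]} :=
  [seq C6 (tnth t 0) (tnth t 1) (tnth t 2) (tnth t 3) (tnth t 4) (tnth t 5)
  | t : 6.-tuple 'I_n in increasing n 6].

Lemma quadricsE :
  quadrics K n = [seq gen (lead4 t) | t : 4.-tuple 'I_n in increasing n 4].
Proof. by []. Qed.

Lemma cubics5E :
  cubics5 K n = [seq gen (lead5 t) | t : 5.-tuple 'I_n in increasing n 5].
Proof. by apply: eq_map => t; rewrite generator5. Qed.

Lemma cubics6_ofE :
  cubics6_of = [seq gen (lead6 t) | t : 6.-tuple 'I_n in increasing n 6].
Proof.
apply/eq_in_map => t; rewrite mem_enum => t_incr.
by rewrite generator6 // (increasing_lt t_incr).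
Qed.

Lemma mem_generators g :
  g \in quadrics K n ++ cubics5 K n ++ cubics6_of <-> exists2 s, is_lead s & g = gen s.
Proof.
rewrite quadricsE cubics5E cubics6_ofE !mem_cat; split.
  case/or3P=> /imageP[t t_incr ->].
  - by exists (lead4 t); first exact: lead4P.
  - by exists (lead5 t); first exact: lead5P.
  - by exists (lead6 t); first exact: lead6P.
move=> [_ /leadP[i j k l ijk kl|i j k l m ijk klm|i j k l m r ijk klm mr] ->];
  apply/or3P.
- constructor 1; apply/imageP; exists [tuple i; j; k; l] => //.
  by rewrite inE /=; lia.
- constructor 2; apply/imageP; exists [tuple i; j; k; l; m] => //.
  by rewrite inE /=; lia.
- constructor 3; apply/imageP; exists [tuple i; j; k; l; m; r] => //.
  by rewrite inE /=; lia.
Qed.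

Hypothesis gen_exp : forall s, is_lead s -> exists L, expansion (gen s) s L.
Hypothesis gen_ideal : forall s, is_lead s -> gen s \in I.
Local Notation G := (quadrics K n ++ cubics5 K n ++ cubics6_of).

Lemma gen_lexlead s : is_lead s -> lexlead (gen s) = arc_mon s.
Proof. by move=> /gen_exp[L /expansion_lexlead]. Qed.

Lemma lead_arc_mon_le s t :
  is_lead s -> is_lead t -> (arc_mon s <= arc_mon t)%MM -> s = t.
Proof.
move=> sl tl st; apply: is_lead_sub => //.
by apply: arc_mon_sub st; apply: is_lead_arcs.
Qed.

Lemma gen_inj s t : is_lead s -> is_lead t -> gen s = gen t -> s = t.
Proof.
move=> sl tl st; apply: lead_arc_mon_le => //.
by rewrite -!gen_lexlead // st lepm_refl.
Qed.

Lemma generators_monic g : g \in G -> g@_(lexlead g) = 1.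
Proof.
move=> /mem_generators[s sl ->]; rewrite gen_lexlead //.
by have [L /expansion_coef] := gen_exp sl.
Qed.

Lemma generators_groebner : groebner_basis I G.
Proof.
apply: groebner_basisP => [g /mem_generators[s sl ->]|g|f fI f0].
- exact: gen_ideal.
- exact: generators_monic.
have [s sl s_f] := lead_divides fI f0; exists (gen s); last by rewrite gen_lexlead.
by apply/mem_generators; exists s.
Qed.

Lemma generators_minimal g h :
  g \in G -> h \in G -> h != g -> ~~ (lexlead h <= lexlead g)%MM.
Proof.
move=> /mem_generators[s sl ->] /mem_generators[t tl ->].
rewrite !gen_lexlead //; apply: contraNN => le_ts.
by rewrite (lead_arc_mon_le tl sl le_ts).
Qed.

(** Generators with different leading arcs are different, and the three kinds
    have different leading arcs: two, three with r.1 = p.2, three with r.1 < p.2. *)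
Lemma uniq_generators : uniq G.
Proof.
have uniq_image d (lead : d.-tuple 'I_n -> seq ('I_n * 'I_n)) :
    injective lead -> {in increasing n d, forall v, is_lead (lead v)} ->
    uniq [seq gen (lead t) | t : d.-tuple 'I_n in increasing n d].
  move=> lead_inj leadl; rewrite map_inj_in_uniq ?enum_uniq // => v w.
  by rewrite !mem_enum => /leadl vl /leadl wl /(gen_inj vl wl)/lead_inj.
rewrite !cat_uniq quadricsE cubics5E cubics6_ofE !uniq_image //=;
  try by [apply: lead4_inj|apply: lead5_inj|apply: lead6_inj|
          apply: lead4P|apply: lead5P|apply: lead6P].
rewrite !andbT; apply/andP; split; apply/hasPn => g.
  rewrite mem_cat => /orP[]/imageP[t t_incr ->]; apply/negP => /imageP[u u_incr].
    by move/(gen_inj (lead5P t_incr) (lead4P u_incr)).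
  by move/(gen_inj (lead6P t_incr) (lead4P u_incr)).
move=> /imageP[t t_incr ->]; apply/negP => /imageP[u u_incr].
move/(gen_inj (lead6P t_incr) (lead5P u_incr)) => -[_ e3 _ _ e2 _].
by have := increasing_lt t_incr (a := 2) (b := 3) isT; rewrite e2 e3 ltnn.
Qed.

End C6.
End Fin.

Theorem propositionA3 (K : fieldType) (n : nat) :
  let Q := quadrics K n in let C5 := cubics5 K n in let C6 := cubics6 K n in
  let G := Q ++ C5 ++ C6 in
  [/\ [/\ size Q = 'C(n, 4), size C5 = 'C(n, 5), size C6 = 'C(n, 6) & uniq G],
      [/\ forall i j k l : 'I_n, (i < j < k)%N -> (k < l)%N ->
            lead_term (quadric K i j k l) = pvar K i j * pvar K k l,
          forall i j k l m : 'I_n, (i < j < k)%N -> (k < l < m)%N ->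
            lead_term (cubic5 K i j k l m) =
              pvar K i k * pvar K j l * pvar K k m
        & forall i j k l m s : 'I_n, (i < j < k)%N -> (k < l < m)%N ->
            (m < s)%N ->
            lead_term (cubic6 K i j k l m s) =
              pvar K i l * pvar K j m * pvar K k s],
      minimal_groebner_basis (pluecker_ideal K n) G
    & reduced_groebner_basis (pluecker_ideal K n)
        (Q ++ C5 ++ cubics6_tail_reduced K n)].
Proof.
move=> Q C5 C6 G; rewrite /G /C6 -[cubics6 K n]/(cubics6_of (@cubic6 K n)).
have expC := @gen_expansion K n; have idC := @gen_in_ideal K n.
have expR (s : seq ('I_n * 'I_n)) : is_lead s ->
    exists L, expansion (generator (@cubic6_tail_reduced K n) s) s L.
  by move=> /(red_expansion K)[L fL _]; exists L.
have idR := @red_in_ideal K n.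
split.
- split; last exact: uniq_generators.
  + by rewrite size_image -card_ltn_sorted_tuples.
  + by rewrite size_image -card_ltn_sorted_tuples.
  + by rewrite size_image -card_ltn_sorted_tuples.
- split=> [i j k l ijk kl|i j k l m ijk klm|i j k l m s ijk klm ms].
  + rewrite (expansion_lead_term (quadric_expansion K ijk kl)).
    by rewrite arc_mon_pvar2 //; lia.
  + rewrite (expansion_lead_term (cubic5_expansion K ijk klm)).
    by rewrite arc_mon_pvar3 //; lia.
  + rewrite (expansion_lead_term (cubic6_expansion K ijk klm ms)).
    by rewrite arc_mon_pvar3 //; lia.
- split; [exact: generators_groebner | exact: generators_monic |].
  exact: generators_minimal.
rewrite -[cubics6_tail_reduced K n]/(cubics6_of (@cubic6_tail_reduced K n)).
split; [exact: (generators_groebner expR idR) | exact: (generators_monic expR) |].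
move=> g h gG hG hg mu mug; apply/negP => h_mu.
have [mu_lead|mu_tail] := eqVneq mu (lexlead g).
  by move: (generators_minimal expR gG hG hg); rewrite -mu_lead h_mu.
move/mem_generators: gG hg mug mu_tail => [s sl ->] _.
rewrite (gen_lexlead expR) // => mug mu_tail.
have [L fL freeL] := red_expansion K sl.
have [ct ctL mu_ct] := expansion_supp fL mug mu_tail.
move/mem_generators: hG h_mu => [t tl ->]; rewrite (gen_lexlead expR) // mu_ct.
move/arc_mon_sub => sub; apply: (freeL ct ctL t tl); apply: sub.
  exact: is_lead_arcs.
by have /and3P[] := allP fL.2 _ ctL.
Qed.
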